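(* Let $F$ be a non-trivial definably closed ID-field with algebraically closed constant field $C_F$, $G$ an algebraic group defined over $C_F$, and $\alpha\in\mathbb{A}G_e(F)$ in the image of $\ell D$. If $K$ is an iterative differential Galois extension of $F$ for the logarithmic differential equation $\ell D(x)=\alpha$, then $K/F$ is an iterative strongly normal extension.
   Context: Fix a prime $p$. An iterative derivation on a ring $R$ is a sequence $\partial=(\partial_i)_{i\in\omega}$ of maps $R\to R$ with $\partial_0=\mathrm{id}$, such that $\mathbb{D}_\partial\colon R\to R[[\epsilon]]$, $x\mapsto\sum_i\partial_i(x)\epsilon^i$ is a ring homomorphism and $\partial_i\circ\partial_j=\binom{i+j}{i}\partial_{i+j}$. An ID-field is a field with an iterative derivation; its constant field $C_F$ is where all $\partial_i$, $i\ge1$, vanish; non-trivial means $\partial_1\not\equiv0$. $\mathcal{U}$ is a large saturated model of $SCH_p$ (separably closed ID-fields $K$ of characteristic $p$ with $[K:K^p]=p$, $K^p=\ker\partial_1$; stable with QE and EI) containing all ID-fields considered, with constant field $\mathcal{C}$. For $A\subseteq\mathcal{U}$, $F\langle A\rangle$ is the ID-subfield generated by $F\cup A$, $B^s$ the closure under $p$-th roots in $\mathcal{U}$, $F^a$ the relative algebraic closure of $F$ in $\mathcal{U}$; $\operatorname{dcl}(A)=\langle A\rangle^s$, and definably closed means $\operatorname{dcl}(F)=F$. Arc bundles: for a variety $X$ and field $k$, $\mathbb{A}X(k)=X(k[[\epsilon]])$; for an algebraic group $G$, $\pi\colon\mathbb{A}G\to G$ is reduction mod $\epsilon$, $\mathbb{A}G_e=\ker\pi$,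 $s\colon G\to\mathbb{A}G$ the inclusion $g\mapsto(g,0,0,\dots)$, $h(x)=x\cdot s(\pi(x))^{-1}$, $\nabla(g)=(\partial_0g,\partial_1g,\dots)$ is the image of $g$ under $\mathbb{D}_\partial$, and $\ell D(g)=h(\nabla(g))$ for $g\in G(\mathcal{U})$. An iterative differential Galois extension of $F$ for $\ell D(x)=\alpha$ is $K=F\langle a\rangle^s$ with $a\in G(\mathcal{U})$, $\ell D(a)=\alpha$, $C_K=C_F$. An extension $F\subseteq K$ of non-trivial definably closed ID-fields is strongly normal if: (1) $C_F=C_K$ is algebraically closed; (2) $K=F\langle b\rangle^s$ for a finite tuple $b$; (3) every ID-embedding $\sigma\colon K\to\mathcal{U}$ over $F$ has $\sigma(K)\subseteq K\langle\mathcal{C}\rangle$; (4) $F^a\cap K=F\langle d\rangle^s$ for a finite tuple $d$. *)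

(* Defs.v *)
From HB Require Import structures.
From mathcomp Require Import all_boot all_order all_algebra all_field.
From mathcomp Require Import boolp classical_sets functions cardinality.

Set Implicit Arguments.
Unset Strict Implicit.
Unset Printing Implicit Defensive.

Import GRing.Theory.
Local Open Scope classical_set_scope.
Local Open Scope ring_scope.

Record fps (R : comPzRingType) := FPS { fpscoef : nat -> R }.

Notation "{ 'fps' R }" := (fps R) (at level 0, format "{ 'fps'  R }").

HB.instance Definition _ (R : comPzRingType) := gen_eqMixin {fps R}.
HB.instance Definition _ (R : comPzRingType) := gen_choiceMixin {fps R}.

Section FpsRing.
Variable R : comPzRingType.
Implicit Types x y z : {fps R}.

Lemma fpsP x y : (forall i, fpscoef x i = fpscoef y i) -> x = y.
Proof. by case: x y => [x] [y] /= /funext ->. Qed.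

Definition fps0 : {fps R} := FPS (fun=> 0).
Definition fps_opp x : {fps R} := FPS (fun i => - fpscoef x i).
Definition fps_add x y : {fps R} := FPS (fun i => fpscoef x i + fpscoef y i).
Definition fps1 : {fps R} := FPS (fun i => (i == 0)%:R).
Definition fps_mul x y : {fps R} :=
  FPS (fun i => \sum_(j < i.+1) fpscoef x j * fpscoef y (i - j)).

Fact fps_addA : associative fps_add.
Proof. by move=> x y z; apply: fpsP => i /=; rewrite addrA. Qed.
Fact fps_addC : commutative fps_add.
Proof. by move=> x y; apply: fpsP => i /=; rewrite addrC. Qed.
Fact fps_add0 : left_id fps0 fps_add.
Proof. by move=> x; apply: fpsP => i /=; rewrite add0r. Qed.
Fact fps_addN : left_inverse fps0 fps_opp fps_add.
Proof. by move=> x; apply: fpsP => i /=; rewrite addNr. Qed.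

HB.instance Definition _ :=
  GRing.isZmodule.Build {fps R} fps_addA fps_addC fps_add0 fps_addN.

Fact fps_mulC : commutative fps_mul.
Proof.
move=> x y; apply: fpsP => i /=.
rewrite (reindex_inj rev_ord_inj) /=; apply: eq_bigr => j _.
by rewrite subSS subKn ?leq_ord // mulrC.
Qed.

Fact fps_mulA : associative fps_mul.
Proof.
move=> x y z; apply: fpsP => i /=.
rewrite [RHS](reindex_inj rev_ord_inj) /=.
pose coef3 j k := fpscoef x j * (fpscoef y (i - j - k) * fpscoef z k).
transitivity (\sum_(j < i.+1) \sum_(k < i.+1 | (k <= i - j)%N) coef3 j k).
  apply: eq_bigr => /= j _; rewrite (reindex_inj rev_ord_inj) /= big_distrr /=.
  rewrite (big_ord_narrow_leq (leq_subr _ _)); apply: eq_bigr => k _ /=.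
  by rewrite /coef3 subSS subKn ?leq_ord.
rewrite (exchange_big_dep predT) //=; apply: eq_bigr => k _.
transitivity (\sum_(j < i.+1 | (j <= i - k)%N) coef3 j k).
  apply: eq_bigl => j; rewrite -ltnS -(ltnS j) -!subSn ?leq_ord //.
  by rewrite -subn_gt0 -(subn_gt0 j) -!subnDA addnC.
rewrite (big_ord_narrow_leq (leq_subr _ _)) subSS subKn ?leq_ord //.
rewrite big_distrl /=.
by apply: eq_bigr => j _; rewrite /coef3 -!subnDA addnC mulrA.
Qed.

Fact fps_mul1 : left_id fps1 fps_mul.
Proof.
move=> x; apply: fpsP => i /=.
by rewrite big_ord_recl big1 ?subn0 => [|j _] /=; rewrite ?mul0r // mul1r addr0.
Qed.

Fact fps_mulDl : left_distributive fps_mul fps_add.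
Proof.
move=> x y z; apply: fpsP => i /=; rewrite -big_split /=.
by apply: eq_bigr => j _; rewrite mulrDl.
Qed.

HB.instance Definition _ := GRing.Zmodule_isComPzRing.Build {fps R}
  fps_mulA fps_mulC fps_mul1 fps_mulDl.

Definition fpsC (c : R) : {fps R} := FPS (fun i => if i is 0 then c else 0).

Fact fpsC_zmod : zmod_morphism fpsC.
Proof. by move=> x y; apply: fpsP => -[|i] //=; rewrite subr0. Qed.
Fact fpsC_monoid : monoid_morphism fpsC.
Proof.
split=> [|x y]; apply: fpsP => -[|i] //=; first by rewrite big_ord1.
by rewrite big_ord_recl mulr0 big1 ?addr0 // => j _; rewrite mul0r.
Qed.
HB.instance Definition _ := GRing.isZmodMorphism.Build R {fps R} fpsC fpsC_zmod.
HB.instance Definition _ :=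
  GRing.isMonoidMorphism.Build R {fps R} fpsC fpsC_monoid.

Definition fps_eval0 (x : {fps R}) : R := fpscoef x 0.

Fact fps_eval0_zmod : zmod_morphism fps_eval0.
Proof. by []. Qed.
Fact fps_eval0_monoid : monoid_morphism fps_eval0.
Proof. by split=> // x y; rewrite /fps_eval0 /= big_ord1. Qed.
HB.instance Definition _ :=
  GRing.isZmodMorphism.Build {fps R} R fps_eval0 fps_eval0_zmod.
HB.instance Definition _ :=
  GRing.isMonoidMorphism.Build {fps R} R fps_eval0 fps_eval0_monoid.

End FpsRing.

Section FpsMap.
Variables (R S : comPzRingType) (f : {rmorphism R -> S}).

Definition fps_map (x : {fps R}) : {fps S} := FPS (fun i => f (fpscoef x i)).

Fact fps_map_zmod : zmod_morphism fps_map.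
Proof. by move=> x y; apply: fpsP => i /=; rewrite rmorphB. Qed.
Fact fps_map_monoid : monoid_morphism fps_map.
Proof.
split=> [|x y]; apply: fpsP => i /=; first by rewrite rmorph_nat.
by rewrite rmorph_sum; apply: eq_bigr => j _; rewrite rmorphM.
Qed.
HB.instance Definition _ :=
  GRing.isZmodMorphism.Build {fps R} {fps S} fps_map fps_map_zmod.
HB.instance Definition _ :=
  GRing.isMonoidMorphism.Build {fps R} {fps S} fps_map fps_map_monoid.

End FpsMap.

HB.mixin Record hasIterativeDerivation R of GRing.ComPzRing R := {
  ider : nat -> R -> R;
  ider0 : forall x, ider 0 x = x;
  taylor_zmod_subproof :
    zmod_morphism (fun x : R => FPS (fun i => ider i x));
  taylor_monoid_subproof :
    monoid_morphism (fun x : R => FPS (fun i => ider i x));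
  ider_comp : forall i j x, ider i (ider j x) = ider (i + j) x *+ 'C(i + j, i)
}.

#[short(type="idFieldType")]
HB.structure Definition IDField :=
  {F of GRing.Field F & hasIterativeDerivation F}.

(* the map D_\partial *)
Definition taylor (U : idFieldType) (x : U) : {fps U} :=
  FPS (fun i => ider i x).

HB.instance Definition _ (U : idFieldType) :=
  GRing.isZmodMorphism.Build U {fps U} (@taylor U) taylor_zmod_subproof.
HB.instance Definition _ (U : idFieldType) :=
  GRing.isMonoidMorphism.Build U {fps U} (@taylor U) taylor_monoid_subproof.

Section IderTheory.
Variable U : idFieldType.

Lemma iderB i (x y : U) : ider i (x - y) = ider i x - ider i y.
Proof. by have /(congr1 (@fpscoef _ ^~ i)) := rmorphB (@taylor U) x y. Qed.

Lemma ider_1 i : ider i (1 : U) = (i == 0)%:R.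
Proof. by have /(congr1 (@fpscoef _ ^~ i)) := rmorph1 (@taylor U). Qed.

Lemma iderM i (x y : U) :
  ider i (x * y) = \sum_(j < i.+1) ider j x * ider (i - j) y.
Proof. by have /(congr1 (@fpscoef _ ^~ i)) := rmorphM (@taylor U) x y. Qed.

End IderTheory.

Record idSubfield (U : idFieldType) := IDSubfield {
  idsub_set :> set U;
  idsub1 : idsub_set 1;
  idsubB : forall x y, idsub_set x -> idsub_set y -> idsub_set (x - y);
  idsub_div : forall x y, idsub_set x -> idsub_set y -> idsub_set (x / y);
  idsub_ider : forall i x, idsub_set x -> idsub_set (ider i x)
}.

Section IDSubfieldType.
Variables (U : idFieldType) (L : idSubfield U).

Definition idsub_pred : pred U := fun x => x \in (L : set U).

Fact idsub_pred_divring : divring_closed idsub_pred.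
Proof.
by split=> [|x y|x y]; rewrite /in_mem /= /idsub_pred !in_setE;
   [exact: idsub1|exact: idsubB|exact: idsub_div].
Qed.
HB.instance Definition _ :=
  GRing.isDivringClosed.Build U idsub_pred idsub_pred_divring.

Record idsub_type : Type :=
  IDSub { idsub_val : U; _ : idsub_pred idsub_val }.

HB.instance Definition _ := [isSub for idsub_val].
HB.instance Definition _ := [Choice of idsub_type by <:].
HB.instance Definition _ := [SubChoice_isSubIntegralDomain of idsub_type by <:].
HB.instance Definition _ := [SubIntegralDomain_isSubField of idsub_type by <:].

Fact idsub_val_zmod : zmod_morphism idsub_val.
Proof. exact: (rmorphB (val : idsub_type -> U)). Qed.
Fact idsub_val_monoid : monoid_morphism idsub_val.
Proof.
by split; [exact: (rmorph1 (val : idsub_type -> U))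
          |exact: (rmorphM (val : idsub_type -> U))].
Qed.
HB.instance Definition _ :=
  GRing.isZmodMorphism.Build idsub_type U idsub_val idsub_val_zmod.
HB.instance Definition _ :=
  GRing.isMonoidMorphism.Build idsub_type U idsub_val idsub_val_monoid.

Lemma idsub_valP (x : idsub_type) : (L : set U) (idsub_val x).
Proof. by have := valP x; rewrite /idsub_pred in_setE. Qed.

Definition idsub_mk (x : U) (Lx : (L : set U) x) : idsub_type :=
  IDSub (mem_set Lx : idsub_pred x).

Lemma idsub_val_inj : injective idsub_val.
Proof. exact: val_inj. Qed.

Definition idsub_der i (x : idsub_type) : idsub_type :=
  idsub_mk (idsub_ider i (idsub_valP x)).

Fact idsub_der0 x : idsub_der 0 x = x.
Proof. by apply: idsub_val_inj; rewrite [LHS]ider0. Qed.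
Fact idsub_der_zmod :
  zmod_morphism (fun x : idsub_type => FPS (fun i => idsub_der i x)).
Proof.
move=> x y; apply: fpsP => i; apply: idsub_val_inj.
by rewrite [RHS](rmorphB idsub_val) [LHS]/= -iderB -(rmorphB idsub_val).
Qed.
Fact idsub_der_monoid :
  monoid_morphism (fun x : idsub_type => FPS (fun i => idsub_der i x)).
Proof.
split=> [|x y]; apply: fpsP => i; apply: idsub_val_inj.
  by rewrite [RHS](rmorph_nat idsub_val) -ider_1 -(rmorph1 idsub_val).
rewrite [RHS](rmorph_sum idsub_val).
under eq_bigr do rewrite (rmorphM idsub_val).
by rewrite -iderM -(rmorphM idsub_val).
Qed.
Fact idsub_der_comp i j x :
  idsub_der i (idsub_der j x) = idsub_der (i + j) x *+ 'C(i + j, i).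
Proof.
by apply: idsub_val_inj; rewrite (rmorphMn idsub_val) -[RHS]ider_comp.
Qed.
HB.instance Definition _ := hasIterativeDerivation.Build idsub_type
  idsub_der0 idsub_der_zmod idsub_der_monoid idsub_der_comp.

End IDSubfieldType.

Section IDSubfieldIncl.
Variables (U : idFieldType) (L M : idSubfield U).
Hypothesis sLM : (L : set U) `<=` M.

Definition idsub_incl (x : idsub_type L) : idsub_type M :=
  idsub_mk (sLM (idsub_valP x)).

Fact idsub_incl_zmod : zmod_morphism idsub_incl.
Proof.
move=> x y; apply: idsub_val_inj.
by rewrite (rmorphB (@idsub_val _ M)) [LHS](rmorphB (@idsub_val _ L)).
Qed.
Fact idsub_incl_monoid : monoid_morphism idsub_incl.
Proof.
split=> [|x y]; apply: idsub_val_inj.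
  by rewrite (rmorph1 (@idsub_val _ M)) [LHS](rmorph1 (@idsub_val _ L)).
by rewrite (rmorphM (@idsub_val _ M)) [LHS](rmorphM (@idsub_val _ L)).
Qed.
HB.instance Definition _ := GRing.isZmodMorphism.Build
  (idsub_type L) (idsub_type M) idsub_incl idsub_incl_zmod.
HB.instance Definition _ := GRing.isMonoidMorphism.Build
  (idsub_type L) (idsub_type M) idsub_incl idsub_incl_monoid.

End IDSubfieldIncl.

Definition id_constants (U : idFieldType) : set U :=
  [set x | forall i, (0 < i)%N -> ider i x = 0].

Section Constants.
Variable U : idFieldType.

Lemma id_constantsP (x : U) : id_constants x <-> taylor x = fpsC x.
Proof.
split=> [cx|/(congr1 (@fpscoef U)) cx [//|i] _].
  by apply: fpsP => -[|i] /=; [exact: ider0|exact: cx].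
by have := congr1 (@^~ i.+1) cx.
Qed.

Lemma id_constants_div (x y : U) :
  id_constants x -> id_constants y -> id_constants (x / y).
Proof.
move=> /id_constantsP cx /id_constantsP cy; apply/id_constantsP.
have [->|y0] := eqVneq y 0; first by rewrite invr0 mulr0 !rmorph0.
have tV : taylor y * taylor y^-1 = 1 by rewrite -rmorphM divff // rmorph1.
have cV : taylor y * fpsC y^-1 = 1 by rewrite cy -rmorphM divff // rmorph1.
rewrite !rmorphM /= cx; congr (_ * _).
by rewrite -[LHS]mul1r -cV mulrAC tV mul1r.
Qed.

Variable L : idSubfield U.
Let C : set U := (L : set U) `&` @id_constants U.

Let C1 : C 1.
Proof. by split=> [|i i0]; [exact: idsub1|rewrite ider_1 gtn_eqF]. Qed.
Let CB x y : C x -> C y -> C (x - y).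
Proof.
move=> [Lx cx] [Ly cy]; split=> [|i i0]; first exact: idsubB.
by rewrite iderB cx // cy // subr0.
Qed.
Let Cdiv x y : C x -> C y -> C (x / y).
Proof.
by move=> [Lx cx] [Ly cy]; split; [exact: idsub_div|exact: id_constants_div].
Qed.
Let Cder i x : C x -> C (ider i x).
Proof.
case: i => [|i] [Lx cx]; first by rewrite ider0.
by rewrite cx // -[0](subrr 1); exact: CB.
Qed.

Definition constants : idSubfield U := IDSubfield C1 CB Cdiv Cder.

Lemma constants_sub : (constants : set U) `<=` L.
Proof. by move=> x []. Qed.

End Constants.

(* F⟨A⟩ is [idgen (F `|` A)]. *)
Definition idgen (U : idFieldType) (A : set U) : set U :=
  [set x | forall L : idSubfield U, A `<=` L -> (L : set U) x].

Definition proot_closure (p : nat) (U : idFieldType) (B : set U) : set U :=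
  [set x | exists n, B (x ^+ (p ^ n))].

Definition dcl (p : nat) (U : idFieldType) (A : set U) : set U :=
  proot_closure p (idgen A).

Definition definably_closed (p : nat) (U : idFieldType) (L : idSubfield U) :=
  dcl p L = L :> set U.

Definition nontrivial_idfield (U : idFieldType) (L : idSubfield U) :=
  exists2 x, (L : set U) x & ider 1 x != 0.

Definition rel_alg_closure (U : idFieldType) (L : idSubfield U) : set U :=
  [set x | algebraicOver (@idsub_val U L) x].

Definition separably_closed (K : fieldType) :=
  forall q : {poly K}, separable_poly q -> (1 < size q)%N ->
  exists x, root q x.

(* [K : K^p] = p: there is a basis of p elements of K over its subfield K^p *)
Definition imperfection_degree_p (p : nat) (K : fieldType) :=
  exists b : 'I_p -> K, forall x : K,
    exists! c : {ffun 'I_p -> K},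
      (forall i, exists y, c i = y ^+ p) /\ x = \sum_i c i * b i.

Definition SCH_model (p : nat) (U : idFieldType) :=
  [/\ p \in [pchar U],
      separably_closed U,
      imperfection_degree_p p U
    & forall x : U, ider 1 x = 0 <-> exists y, x = y ^+ p].

(* Terms and formulas of the language of rings with unary function symbols
   \partial_i and with parameters from U, in n free variables. *)
Inductive id_term (U : Type) (n : nat) : Type :=
| TVar of 'I_n
| TParam of U
| TZero
| TOne
| TOpp of id_term U n
| TAdd of id_term U n & id_term U n
| TMul of id_term U n & id_term U n
| TDer of nat & id_term U n.

Inductive id_formula (U : Type) : nat -> Type :=
| FEq n : id_term U n -> id_term U n -> id_formula U n
| FNot n : id_formula U n -> id_formula U n
| FAnd n : id_formula U n -> id_formula U n -> id_formula U n
| FEx n : id_formula U n.+1 -> id_formula U n.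

Fixpoint id_eval (U : idFieldType) n (e : 'I_n -> U) (t : id_term U n) : U :=
  match t with
  | TVar i => e i
  | TParam a => a
  | TZero => 0
  | TOne => 1
  | TOpp t1 => - id_eval e t1
  | TAdd t1 t2 => id_eval e t1 + id_eval e t2
  | TMul t1 t2 => id_eval e t1 * id_eval e t2
  | TDer i t1 => ider i (id_eval e t1)
  end.

Definition env_cons (U : Type) n (x : U) (e : 'I_n -> U) (i : 'I_n.+1) : U :=
  if unlift ord0 i is Some j then e j else x.

Fixpoint id_holds (U : idFieldType) n (f : id_formula U n) :
    ('I_n -> U) -> Prop :=
  match f in id_formula _ m return ('I_m -> U) -> Prop with
  | FEq _ t1 t2 => fun e => id_eval e t1 = id_eval e t2
  | FNot _ f1 => fun e => ~ id_holds f1 e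
  | FAnd _ f1 f2 => fun e => id_holds f1 e /\ id_holds f2 e
  | FEx _ f1 => fun e => exists x, id_holds f1 (env_cons x e)
  end.

Fixpoint term_over (U : Type) (A : set U) n (t : id_term U n) : Prop :=
  match t with
  | TParam a => A a
  | TVar _ | TZero | TOne => True
  | TOpp t1 | TDer _ t1 => term_over A t1
  | TAdd t1 t2 | TMul t1 t2 => term_over A t1 /\ term_over A t2
  end.

Fixpoint formula_over (U : Type) (A : set U) n (f : id_formula U n) : Prop :=
  match f with
  | FEq _ t1 t2 => term_over A t1 /\ term_over A t2
  | FNot _ f1 => formula_over A f1
  | FAnd _ f1 f2 => formula_over A f1 /\ formula_over A f2
  | FEx _ f1 => formula_over A f1
  end.

(* U realizes every 1-type over every A with |A| < |U| *)
Definition saturated (U : idFieldType) :=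
  forall A : set U, ~~ ([set: U] #<= A)%card ->
  forall Gamma : set (id_formula U 1),
  Gamma `<=` [set f | formula_over A f] ->
  (forall Delta : set (id_formula U 1), finite_set Delta -> Delta `<=` Gamma ->
     exists x, forall f, Delta f -> id_holds f (fun=> x)) ->
  exists x, forall f, Gamma f -> id_holds f (fun=> x).

(* Varieties are given by their functors of points on commutative algebras
   (Demazure-Gabriel). The zero algebra is allowed. *)
Record calg (k : fieldType) := CAlg {
  calg_ring :> comPzRingType;
  calg_str : {rmorphism k -> calg_ring}
}.

Record calg_hom (k : fieldType) (A B : calg k) := CAlgHom {
  calg_hom_fun :> {rmorphism A -> B};
  calg_homP : forall c, calg_hom_fun (calg_str A c) = calg_str B c
}.

(* The first law contains functoriality at the identity; the triangle in the
   second is commutative up to pointwise equality. *)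
Record kfunctor (k : fieldType) := KFunctor {
  kpoints :> calg k -> Type;
  kmap : forall A B : calg k, calg_hom A B -> kpoints A -> kpoints B;
  kmap_id : forall (A : calg k) (f : calg_hom A A),
    f =1 id -> kmap f =1 id;
  kmap_comp : forall (A B C : calg k)
    (f : calg_hom A B) (g : calg_hom B C) (h : calg_hom A C),
    h =1 g \o f -> kmap h =1 kmap g \o kmap f
}.

Definition reduced_ring (R : comPzRingType) :=
  forall (x : R) n, x ^+ n = 0 -> x = 0.

Definition finitely_generated_alg (k : fieldType) (A : calg k) :=
  exists (n : nat) (t : 'I_n -> A), forall B : set A,
    (forall c, B (calg_str A c)) -> (forall i, B (t i)) ->
    (forall x y, B x -> B y -> B (x + y)) ->
    (forall x y, B x -> B y -> B (x * y)) ->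
    B = setT.

Definition generates_unit_ideal (R : comPzRingType) (I : set R) :=
  exists (n : nat) (c x : 'I_n -> R),
    (forall i, I (x i)) /\ \sum_i c i * x i = 1.

(* u in X(A) corresponds to a morphism Spec A -> X, which is required to be an
   open immersion: it is a monomorphism, and its pullback along any Spec R -> X
   is the complement of the closed subscheme defined by some I. *)
Definition affine_open (k : fieldType) (X : kfunctor k) (A : calg k) (u : X A) :=
  (forall (R : calg k) (f g : calg_hom A R), kmap f u = kmap g u -> f =1 g)
  /\ forall (R : calg k) (x : X R), exists I : set R,
     forall (S : calg k) (g : calg_hom R S),
       (exists f : calg_hom A S, kmap f u = kmap g x)
       <-> generates_unit_ideal (g @` I).

(* characterizes phi : R -> S as the localization R -> R_f *)
Definition localization_at (k : fieldType) (R S : calg k) (f : R)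
    (phi : calg_hom R S) :=
  [/\ exists v, phi f * v = 1,
      forall s, exists r n, s * phi f ^+ n = phi r
    & forall r, phi r = 0 -> exists n, r * f ^+ n = 0].

Definition zariski_sheaf (k : fieldType) (X : kfunctor k) :=
  forall (R : calg k) (n : nat) (f : 'I_n -> R)
    (S : 'I_n -> calg k) (phi : forall i, calg_hom R (S i))
    (T : 'I_n -> 'I_n -> calg k)
    (lam : forall i j, calg_hom (S i) (T i j))
    (rho : forall i j, calg_hom (S j) (T i j)),
  generates_unit_ideal (range f) ->
  (forall i, localization_at (f i) (phi i)) ->
  (forall i j, localization_at (phi i (f j)) (lam i j)) ->
  (forall i j, lam i j \o phi i =1 rho i j \o phi j) ->
  forall x : (forall i, X (S i)),
  (forall i j, kmap (lam i j) (x i) = kmap (rho i j) (x j)) ->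
  exists! y : X R, forall i, kmap (phi i) y = x i.

(* the diagonal of X is a closed immersion *)
Definition separated (k : fieldType) (X : kfunctor k) :=
  forall (R : calg k) (x y : X R), exists I : set R,
    forall (S : calg k) (g : calg_hom R S),
      kmap g x = kmap g y <-> (forall r, I r -> g r = 0).

(* X is a reduced separated scheme of finite type over k; this is used for
   algebraically closed k only, and X may be reducible. *)
Definition is_variety (k : fieldType) (X : kfunctor k) :=
  [/\ zariski_sheaf X, separated X
    & exists (n : nat) (A : 'I_n -> calg k) (u : forall i, X (A i)),
      (forall i, [/\ affine_open (u i), finitely_generated_alg (A i)
                   & reduced_ring (A i)])
      /\ forall (K : fieldType) (str : {rmorphism k -> K})
           (x : X (CAlg str)),
         exists i (f : calg_hom (A i) (CAlg str)), kmap f (u i) = x].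

Record algGroup (k : fieldType) := AlgGroup {
  ag_variety :> kfunctor k;
  ag_varietyP : is_variety ag_variety;
  ag_mul : forall R : calg k, ag_variety R -> ag_variety R -> ag_variety R;
  ag_one : forall R : calg k, ag_variety R;
  ag_inv : forall R : calg k, ag_variety R -> ag_variety R;
  ag_mul_nat : forall (R S : calg k) (f : calg_hom R S) x y,
    kmap f (ag_mul x y) = ag_mul (kmap f x) (kmap f y);
  ag_one_nat : forall (R S : calg k) (f : calg_hom R S),
    kmap f (ag_one R) = ag_one S;
  ag_inv_nat : forall (R S : calg k) (f : calg_hom R S) x,
    kmap f (ag_inv x) = ag_inv (kmap f x);
  ag_mulA : forall R : calg k, associative (@ag_mul R);
  ag_mul1 : forall R : calg k, left_id (ag_one R) (@ag_mul R);
  ag_mulV : forall R : calg k, left_inverse (ag_one R) (@ag_inv R) (@ag_mul R)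
}.

Definition fps_alg (k : fieldType) (R : calg k) : calg k :=
  @CAlg k {fps R} (@fpsC R \o calg_str R).

Definition arc_bundle (k : fieldType) (X : kfunctor k) (R : calg k) : Type :=
  X (fps_alg R).

Definition fpsC_hom (k : fieldType) (R : calg k) : calg_hom R (fps_alg R) :=
  @CAlgHom k R (fps_alg R) (@fpsC R) (fun=> erefl).

Definition fps_eval0_hom (k : fieldType) (R : calg k) :
    calg_hom (fps_alg R) R :=
  @CAlgHom k (fps_alg R) R (@fps_eval0 R) (fun=> erefl).

Fact fps_map_homP (k : fieldType) (R S : calg k) (f : calg_hom R S) c :
  fps_map f (calg_str (fps_alg R) c) = calg_str (fps_alg S) c.
Proof. by apply: fpsP => -[|i] /=; rewrite ?calg_homP ?rmorph0. Qed.

Definition fps_map_hom (k : fieldType) (R S : calg k) (f : calg_hom R S) :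
    calg_hom (fps_alg R) (fps_alg S) :=
  @CAlgHom k (fps_alg R) (fps_alg S) (fps_map f) (fps_map_homP f).

Definition arc_map (k : fieldType) (X : kfunctor k) (R S : calg k)
    (f : calg_hom R S) : arc_bundle X R -> arc_bundle X S :=
  kmap (fps_map_hom f).

Definition arc_proj (k : fieldType) (X : kfunctor k) (R : calg k) :
    arc_bundle X R -> X R := kmap (fps_eval0_hom R).

Definition arc_sect (k : fieldType) (X : kfunctor k) (R : calg k) :
    X R -> arc_bundle X R := kmap (fpsC_hom R).

Definition arc_h (k : fieldType) (G : algGroup k) (R : calg k)
    (x : arc_bundle G R) : arc_bundle G R :=
  ag_mul x (ag_inv (arc_sect (arc_proj x))).

Section OverConstants.
Variables (U : idFieldType) (F : idSubfield U).
Let k : fieldType := idsub_type (constants F).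

Definition univ_alg : calg k := @CAlg k U (@idsub_val U (constants F)).
Definition base_alg : calg k :=
  @CAlg k (idsub_type F) (idsub_incl (@constants_sub U F)).

Definition base_univ_hom : calg_hom base_alg univ_alg :=
  @CAlgHom k base_alg univ_alg (@idsub_val U F) (fun=> erefl).

Fact taylor_homP c :
  taylor (calg_str univ_alg c) = calg_str (fps_alg univ_alg) c.
Proof. by apply/id_constantsP; have [] := idsub_valP c. Qed.

Definition taylor_hom : calg_hom univ_alg (fps_alg univ_alg) :=
  @CAlgHom k univ_alg (fps_alg univ_alg) (@taylor U) taylor_homP.

Definition nabla (X : kfunctor k) : X univ_alg -> arc_bundle X univ_alg :=
  kmap taylor_hom.

Definition logder (G : algGroup k) (g : G univ_alg) : arc_bundle G univ_alg :=
  arc_h (nabla g).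

(* The coordinates of a in all affine charts containing it, i.e. the image in U
   of the local ring at a. F⟨a⟩ does not depend on the choice of charts. *)
Definition coordinates (X : kfunctor k) (a : X univ_alg) : set U :=
  [set b | exists (A : calg k) (u : X A) (f : calg_hom A univ_alg) (c : A),
     [/\ affine_open u, kmap f u = a & b = f c]].

Definition id_galois_extension (p : nat) (G : algGroup k)
    (alpha : arc_bundle G base_alg) (K : idSubfield U) :=
  exists a : G univ_alg,
    [/\ logder a = arc_map base_univ_hom alpha,
        K = proot_closure p (idgen ((F : set U) `|` coordinates a)) :> set U
      & constants K = constants F :> set U].

End OverConstants.

Definition id_embedding_over (U : idFieldType) (F K : idSubfield U)
    (sigma : {rmorphism idsub_type K -> U}) :=
  (forall i x, sigma (ider i x) = ider i (sigma x)) /\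
  (forall x : idsub_type K, (F : set U) (idsub_val x) -> sigma x = idsub_val x).

Definition strongly_normal (p : nat) (U : idFieldType) (F K : idSubfield U) :=
  [/\ (F : set U) `<=` K,
      nontrivial_idfield F /\ definably_closed p F
    & nontrivial_idfield K /\ definably_closed p K] /\
  [/\ constants F = constants K :> set U /\
        GRing.closed_field_axiom (idsub_type (constants F)),
      exists b : seq U,
        K = proot_closure p (idgen ((F : set U) `|` [set` b])) :> set U,
      forall sigma : {rmorphism idsub_type K -> U},
        id_embedding_over F sigma ->
        range sigma `<=` idgen ((K : set U) `|` @id_constants U)
    & exists d : seq U,
        rel_alg_closure F `&` K =
        proot_closure p (idgen ((F : set U) `|` [set` d])) :> set U].

(* Main.v *)
(** The coordinates of [nabla a = alpha * s(a)] are power series over the field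
    F(a), so F<a> is the finitely generated field F(a), and the relative
    algebraic closure of F in it is finite over F. If sigma embeds K over F,
    then a and sigma(a) solve the same equation, so [c := a^-1 * sigma(a)]
    satisfies [nabla c = s(c)], i.e. c has constant coordinates, and
    [sigma(a) = a * c] is rational over K<C>. Finally K<C> is closed under p-th
    roots: C is perfect and K is spanned over K^p by the powers t^i (i < p) of
    an element t of K with [ider 1 t = 1], so K<C> is spanned over K<C>^p by
    these powers, which are linearly independent over the kernel of [ider 1],
    that is, over U^p. *)

Require Import Defs.
From HB Require Import structures.
From mathcomp Require Import all_boot all_algebra.
From mathcomp Require Import ring boolp classical_sets.

Set Implicit Arguments.
Unset Strict Implicit.
Unset Printing Implicit Defensive.

Import GRing.Theory.
Local Open Scope classical_set_scope.
Local Open Scope ring_scope.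

(** * Functors of points *)

Section Functors.
Variable k : fieldType.

(** A point of G is known only through affine charts. Passing between points and coordinates rests
    on one fact: if a point over a field, or over power series over a field, enters a chart after
    extension of scalars, it already did before, these rings being local. The power series case
    turns an identity between arcs into a statement on derivatives of coordinates. Condition (3)
    asks for sigma(K) inside K<C> itself, whereas K consists of p-power roots of elements of F<a>;
    this is why K<C> must be shown closed under p-th roots. The element t exists because [ider 1] is
    nilpotent: its n-th iterate is n! times [ider n]. Condition (4) also needs the relative
    algebraic closure of F to be stable under every [ider i]; inseparable elements are handled by
    passing to a p-power. *)

Definition calg_id (A : calg k) : calg_hom A A :=
  @CAlgHom k A A idfun (fun=> erefl).

Lemma calg_comp_subproof (A B C : calg k) (g : calg_hom B C)
    (f : calg_hom A B) c : (g \o f) (calg_str A c) = calg_str C c.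
Proof. by rewrite /= !calg_homP. Qed.

Definition calg_comp (A B C : calg k) (g : calg_hom B C) (f : calg_hom A B) :
    calg_hom A C :=
  @CAlgHom k A C (g \o f) (calg_comp_subproof g f).

(** [kmap_comp] accepts triangles that commute pointwise, so a triangle with an identity leg
    suffices. *)
Lemma kmap_eq (X : kfunctor k) (A B : calg k) (f g : calg_hom A B) :
  f =1 g -> kmap f =1 @kmap k X A B g.
Proof.
move=> fg x; have := @kmap_comp k X A A B (calg_id A) g f.
by move=> -> // /=; rewrite (@kmap_id k X A (calg_id A)).
Qed.

Lemma kmapK (X : kfunctor k) (A B C : calg k) (g : calg_hom B C)
  (f : calg_hom A B) (x : X A) : kmap (calg_comp g f) x = kmap g (kmap f x).
Proof. by rewrite (@kmap_comp k X A B C f g (calg_comp g f)). Qed.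

Lemma kmap_square (X : kfunctor k) (A B B' C : calg k) (f : calg_hom A B)
    (g : calg_hom B C) (f' : calg_hom A B') (g' : calg_hom B' C) (x : X A) :
  g \o f =1 g' \o f' -> kmap g (kmap f x) = kmap g' (kmap f' x).
Proof. by move=> e; rewrite -!kmapK; apply: kmap_eq. Qed.

Lemma rmorph_lift (A R S : pzRingType) (j : {rmorphism R -> S})
    (f : {rmorphism A -> S}) :
  injective j -> (forall x, exists y, j y = f x) ->
  exists g : {rmorphism A -> R}, forall x, j (g x) = f x.
Proof.
move=> j_inj /choice[g jg].
have gB : zmod_morphism g by move=> x y; apply: j_inj; rewrite rmorphB !jg rmorphB.
have gM : monoid_morphism g.
  by split=> [|x y]; apply: j_inj; rewrite ?rmorph1 ?rmorphM !jg ?rmorph1 ?rmorphM.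
pose gZ := GRing.isZmodMorphism.Build A R g gB.
pose gR := GRing.isMonoidMorphism.Build A R g gM.
pose g' : {rmorphism A -> R} := HB.pack g gZ gR.
by exists g'.
Qed.

Lemma calg_hom_lift (A R S : calg k) (j : calg_hom R S) (f : calg_hom A S) :
  injective j -> (forall x, exists y, j y = f x) ->
  exists g : calg_hom A R, forall x, j (g x) = f x.
Proof.
move=> j_inj /(rmorph_lift j_inj)[g jg].
have gP c : g (calg_str A c) = calg_str R c.
  by apply: j_inj; rewrite jg !calg_homP.
by exists (CAlgHom gP).
Qed.

(* [phi] detects units of [R]: in the applications [R] is a field, or the power
   series ring over a field with [phi] the evaluation at 0. *)
Lemma affine_open_factor (X : kfunctor k) (A R S : calg k) (u : X A)
    (j : calg_hom R S) (K : fieldType) (phi : {rmorphism S -> K})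
    (z : X R) (f : calg_hom A S) :
  affine_open u ->
  (forall r, phi (j r) != 0 -> exists s, s * r = 1) ->
  kmap f u = kmap j z ->
  exists2 g : calg_hom A R, kmap g u = z & forall x, j (g x) = f x.
Proof.
move=> [u_mono u_open] j_unit fu.
have [I IP] := u_open R z.
have /IP[n [c [x [Ix sum1]]]] : exists f, kmap f u = kmap j z by exists f.
(* [phi] maps to a field, so the relation expressing 1 cannot have all [x i] in its kernel. Such an
   [x i] is the image of a unit of [R], so [I] is the unit ideal before any base change and [z]
   itself lies in the chart. *)
have [i nz] : exists i, phi (x i) != 0.
  apply/not_existsP => all0; have := rmorph1 phi; rewrite -sum1 rmorph_sum /=.
  rewrite big1 => [/esym /eqP|i _]; first by rewrite oner_eq0.
  by apply/eqP; rewrite rmorphM mulf_eq0; apply/orP; right; apply/negPn/negP.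
have [r Ir jr] := Ix i; rewrite -jr in nz.
have [s sr] := j_unit _ nz.
have /IP[g gu] : generates_unit_ideal (calg_id R @` I).
  exists 1, (fun=> s), (fun=> r); split=> [_|]; first by exists r.
  by rewrite big_ord1.
exists g; first by rewrite gu (@kmap_id k X R (calg_id R)).
move=> y; apply: (u_mono S (calg_comp j g) f).
by rewrite kmapK fu gu (@kmap_id k X R (calg_id R)).
Qed.

End Functors.

(** * Power series *)

Section PowerSeries.
Variable R : comPzRingType.
Implicit Types x y : {fps R}.

Definition fpsX : {fps R} := FPS (fun i => (i == 1)%:R).

Lemma fpscoefD x y i : fpscoef (x + y) i = fpscoef x i + fpscoef y i.
Proof. by []. Qed.

Lemma fpscoefM x y i :
  fpscoef (x * y) i = \sum_(j < i.+1) fpscoef x j * fpscoef y (i - j).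
Proof. by []. Qed.

Lemma fpscoefXM x i :
  fpscoef (fpsX * x) i = if i is i'.+1 then fpscoef x i' else 0.
Proof.
rewrite fpscoefM big_ord_recl mul0r add0r; case: i => [|i]; first by rewrite big_ord0.
by rewrite big_ord_recl mul1r subSS subn0 big1 ?addr0 // => j _; rewrite mul0r.
Qed.

Lemma fpscoefXnM x n i :
  fpscoef (fpsX ^+ n * x) i = if (i < n)%N then 0 else fpscoef x (i - n).
Proof.
elim: n i => [|n IHn] i; first by rewrite mul1r subn0.
by rewrite exprS -mulrA fpscoefXM; case: i => // i; rewrite IHn.
Qed.

Lemma fps_split x :
  x = fpsC (fpscoef x 0) + fpsX * FPS (fun i => fpscoef x i.+1).
Proof. by apply: fpsP => -[|i]; rewrite fpscoefD fpscoefXM /= ?addr0 ?add0r. Qed.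

(** Course-of-values recursion for the inverse of [x], where [s] inverts the constant coefficient:
    stage [n] carries the first [n] coefficients, and its values from index [n] on are
    meaningless. *)
Fixpoint fps_inv_approx (s : R) x n : nat -> R :=
  if n is n'.+1 then
    let c := fps_inv_approx s x n' in
    fun i => if (i < n')%N then c i
      else s * ((n' == 0)%:R - \sum_(j < n') c j * fpscoef x (n' - j))
  else fun=> 0.

Lemma fps_inv_approxE s x n i :
  (i < n)%N -> fps_inv_approx s x n i = fps_inv_approx s x i.+1 i.
Proof.
elim: n => // n IHn; rewrite ltnS leq_eqVlt => /orP[/eqP->//|lin].
by rewrite [LHS]/= lin IHn.
Qed.

Lemma fps_unit s x : s * fpscoef x 0 = 1 -> exists y, y * x = 1.
Proof.
move=> sx; exists (FPS (fun i => fps_inv_approx s x i.+1 i)).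
apply: fpsP => n; rewrite fpscoefM big_ord_recr /= ltnn subnn.
under [in X in X + _]eq_bigr => j _.
  rewrite -[X in X * _]/(fps_inv_approx s x j.+1 j) -(fps_inv_approxE s x (ltn_ord j)).
  over.
by rewrite mulrAC sx mul1r addrC subrK.
Qed.

Lemma fpscoef_natmul x n i : fpscoef (x *+ n) i = fpscoef x i *+ n.
Proof. by elim: n => // n IHn; rewrite !mulrS fpscoefD IHn. Qed.

Lemma fps_exprDn_prime p (p_pr : prime p) (pR : p%:R = 0 :> R) x y :
  (x + y) ^+ p = x ^+ p + y ^+ p.
Proof.
have pfps (z : {fps R}) : z *+ p = 0.
  by apply: fpsP => i; rewrite fpscoef_natmul -mulr_natr pR mulr0.
rewrite exprDn; case: p p_pr pR pfps => // p p_pr pR pfps.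
rewrite big_ord_recl big_ord_recr big1 => [|i _] /=; last first.
  have /dvdnP[m ->] : (p.+1 %| 'C(p.+1, bump 0 i))%N.
    by rewrite prime_dvd_bin //= /bump add1n ltnS.
  by rewrite mulnC mulrnA pfps mul0rn.
by rewrite /bump /= add1n bin0 binn subn0 subnn !mulr1n mulr1 mul1r add0r.
Qed.

(** Writing x = c + X y gives x^p = c^p + X^p y^p, which lowers the index by p. *)
Lemma fpscoef_expr_prime p (p_pr : prime p) (pR : p%:R = 0 :> R) x n :
  fpscoef (x ^+ p) n = if (p %| n)%N then fpscoef x (n %/ p) ^+ p else 0.
Proof.
have p_gt0 := prime_gt0 p_pr.
have [m] := ubnP n; elim: m n x => // m IHm n x; rewrite ltnS => le_nm.
rewrite {1}[x]fps_split fps_exprDn_prime // fpscoefD -rmorphXn exprMn fpscoefXnM.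
have [lt_np|le_pn] := ltnP n p.
  rewrite addr0; case: n lt_np {le_nm} => [|n] lt_np; first by rewrite dvdn0 div0n.
  by rewrite gtnNdvd.
rewrite IHm; last by rewrite (leq_trans _ le_nm) // ltn_subrL p_gt0 (leq_trans _ le_pn).
have -> : (n %/ p)%N = ((n - p) %/ p).+1.
  by rewrite -[in LHS](subnK le_pn) divnDr ?dvdnn // divnn p_gt0 addn1.
rewrite -[in RHS](subnK le_pn) dvdn_addl ?dvdnn // (subnK le_pn).
by case: n le_pn {le_nm} => [|n]; rewrite ?add0r // leqNgt p_gt0.
Qed.

End PowerSeries.

(** * Subfields and finitely generated extensions *)

Section SubfieldType.
Variables (U : fieldType) (S : divringClosed U).

(** A field type for a subfield of [U] that need not be stable under derivations, over which
    matrices and [algebraicOver] make sense. *)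
Record sub_field : Type := SubField { sub_field_val : U; _ : sub_field_val \in S }.

HB.instance Definition _ := [isSub for sub_field_val].
HB.instance Definition _ := [Choice of sub_field by <:].
HB.instance Definition _ := [SubChoice_isSubIntegralDomain of sub_field by <:].
HB.instance Definition _ := [SubIntegralDomain_isSubField of sub_field by <:].

Fact sub_field_val_zmod : zmod_morphism sub_field_val.
Proof. exact: (rmorphB (val : sub_field -> U)). Qed.
Fact sub_field_val_monoid : monoid_morphism sub_field_val.
Proof.
by split; [exact: (rmorph1 (val : sub_field -> U))
          |exact: (rmorphM (val : sub_field -> U))].
Qed.
HB.instance Definition _ :=
  GRing.isZmodMorphism.Build sub_field U sub_field_val sub_field_val_zmod.
HB.instance Definition _ :=
  GRing.isMonoidMorphism.Build sub_field U sub_field_val sub_field_val_monoid.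

Lemma sub_field_valP (x : sub_field) : sub_field_val x \in S.
Proof. exact: valP x. Qed.

Lemma sub_field_val_inj : injective sub_field_val.
Proof. exact: val_inj. Qed.

End SubfieldType.

Section SubfieldOfSet.
Variables (U : fieldType) (A : set U).
Hypotheses (A1 : A 1) (AB : forall x y, A x -> A y -> A (x - y)).
Hypothesis Adiv : forall x y, A x -> A y -> A (x / y).

Definition set_pred : pred U := fun x => x \in A.

Fact set_pred_divring : divring_closed set_pred.
Proof.
by split=> [|x y|x y]; rewrite /in_mem /= /set_pred !in_setE; [|exact: AB|exact: Adiv].
Qed.

Definition subfield_of_set : divringClosed U :=
  HB.pack set_pred (GRing.isDivringClosed.Build U set_pred set_pred_divring).

Lemma subfield_of_setP x : x \in subfield_of_set <-> A x.
Proof. by rewrite /in_mem /= /set_pred in_setE. Qed.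

End SubfieldOfSet.

(** * Relative algebraic closures and generated subfields *)

Section Algebraic.
Variable U : fieldType.
Implicit Types (S T : divringClosed U) (x t : U) (s : seq U).

Lemma polyOver_lift (E : fieldType) (v : {rmorphism E -> U}) S (P : {poly U}) :
    (forall x, x \in S -> exists y, v y = x) ->
  P \is a polyOver S -> exists Q, map_poly v Q = P.
Proof.
move=> vS /polyOverP SP.
have /choice[g vg] : forall i, exists y, v y = P`_i by move=> i; apply/vS/SP.
exists (\poly_(i < size P) g i); apply/polyP => i; rewrite coef_map coef_poly.
by case: ltnP => [_|le] /=; rewrite ?vg // rmorph0 nth_default.
Qed.

(** Replaces the base field type by a predicate on [U], so that the base can grow without a change
    of type. *)
Lemma algebraicOverP (E : fieldType) (v : {rmorphism E -> U}) S :
    (forall x, x \in S <-> exists y, v y = x) ->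
  forall x, algebraicOver v x <->
    exists P : {poly U}, [/\ P != 0, P \is a polyOver S & root P x].
Proof.
move=> vS x; split=> [[P nzP Px]|[P [nzP SP Px]]].
  exists (map_poly v P); split; rewrite ?map_poly_eq0 //.
  by apply/polyOverP => i; rewrite coef_map; apply/vS; exists P`_i.
have [|Q PQ] := @polyOver_lift E v S P _ SP; first by move=> y /vS.
by exists Q; rewrite ?PQ // -(map_poly_eq0 v) PQ.
Qed.

Lemma sub_field_valE S x : x \in S <-> exists y : sub_field S, sub_field_val y = x.
Proof.
by split=> [Sx|[y <-]]; [exists (SubField Sx)|exact: sub_field_valP].
Qed.

Definition acl S : divringClosed U := @subfield_of_set U
  [set x | algebraicOver (@sub_field_val U S) x]
  (algebraic1 _) (@algebraic_sub _ _ _) (@algebraic_div _ _ _).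

Lemma acl_algebraic S x : x \in acl S <-> algebraicOver (@sub_field_val U S) x.
Proof. exact: subfield_of_setP. Qed.

Lemma aclP S x : x \in acl S <->
  exists P : {poly U}, [/\ P != 0, P \is a polyOver S & root P x].
Proof.
by apply: iff_trans (acl_algebraic S x) _; apply/algebraicOverP/sub_field_valE.
Qed.

Lemma sub_acl S : {subset S <= acl S}.
Proof.
move=> x Sx; apply/aclP; exists ('X - x%:P); split; last by rewrite root_XsubC.
  by rewrite polyXsubC_eq0.
by rewrite polyOverXsubC.
Qed.

Lemma aclS S T : {subset S <= T} -> {subset acl S <= acl T}.
Proof.
move=> ST x /aclP[P [nzP SP Px]]; apply/aclP; exists P; split=> //.
by apply: polyOverS SP.
Qed.

Lemma acl_root S P x :
  P != 0 -> P \is a polyOver (acl S) -> root P x -> x \in acl S.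
Proof.
move=> nzP /polyOverP SP Px; apply/acl_algebraic/integral_algebraic.
apply: integral_root nzP Px _ => y /(nthP 0)[i _ <-].
exact/integral_algebraic/acl_algebraic.
Qed.

Lemma acl_exp S x n : (0 < n)%N -> x ^+ n \in acl S -> x \in acl S.
Proof.
move=> n0 Sx; apply: (@acl_root _ ('X^n - (x ^+ n)%:P)).
- by rewrite -size_poly_eq0 size_XnsubC.
- by rewrite rpredB ?polyOverC // rpredX ?polyOverX.
- by rewrite rootE !hornerE subrr.
Qed.

Definition gen_set S (s : seq U) : set U :=
  [set x | forall T : divringClosed U,
     {subset S <= T} -> {subset s <= T} -> x \in T].

Definition gen S s : divringClosed U.
Proof.
refine (@subfield_of_set U (gen_set S s) _ _ _).
- by move=> T _ _; rewrite rpred1.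
- by move=> x y Sx Sy T ST sT; rewrite rpredB ?Sx ?Sy.
- by move=> x y Sx Sy T ST sT; rewrite rpred_div ?Sx ?Sy.
Defined.

Lemma sub_gen S s : {subset S <= gen S s}.
Proof. by move=> x Sx; apply/subfield_of_setP => T ST _; apply: ST. Qed.

Lemma mem_gen S s : {subset s <= gen S s}.
Proof. by move=> x sx; apply/subfield_of_setP => T _; apply. Qed.

Lemma gen_min S s T :
  {subset S <= T} -> {subset s <= T} -> {subset gen S s <= T}.
Proof. by move=> ST sT x /subfield_of_setP; apply. Qed.

Lemma gen_cons S t s : gen S (t :: s) =i gen (gen S [:: t]) s.
Proof.
move=> x; apply/idP/idP; apply: gen_min => y.
- by move=> Sy; do 2!apply: sub_gen.
- rewrite inE => /predU1P[->|sy]; last exact: mem_gen.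
  by apply/sub_gen/mem_gen; rewrite mem_head.
- apply: gen_min => [z|z]; first exact: sub_gen.
  by rewrite inE => /eqP->; apply/mem_gen/mem_head.
- by move=> sy; apply: mem_gen; rewrite inE sy orbT.
Qed.

Definition fraction_set S t : set U :=
  [set x | exists q r : {poly U}, [/\ q \is a polyOver S, r \is a polyOver S,
     r.[t] != 0 & x = q.[t] / r.[t]]].

Definition fractions S t : divringClosed U.
Proof.
refine (@subfield_of_set U (fraction_set S t) _ _ _).
- by exists 1, 1; split; rewrite ?rpred1 // hornerC ?oner_eq0 ?divr1.
- move=> _ _ [q [r [Sq Sr nzr ->]]] [q' [r' [Sq' Sr' nzr' ->]]].
  exists (q * r' - q' * r), (r * r').
  split; rewrite ?rpredB ?rpredM // !hornerE ?mulf_neq0 //.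
  by rewrite -mulNr addf_div // mulNr.
- move=> _ _ [q [r [Sq Sr nzr ->]]] [q' [r' [Sq' Sr' nzr' ->]]].
  have [q0|nzq'] := eqVneq q'.[t] 0.
    exists 0, 1; split; rewrite ?rpred0 ?rpred1 ?horner0 ?hornerC ?oner_eq0 //.
    by rewrite q0 !mul0r invr0 mulr0.
  exists (q * r'), (r * q'); split; rewrite ?rpredM // !hornerE ?mulf_neq0 //.
  by rewrite invf_div mulf_div.
Defined.

Lemma gen1_fraction S t x : x \in gen S [:: t] -> fraction_set S t x.
Proof.
move=> Sx; suff /subfield_of_setP : x \in fractions S t by [].
apply: gen_min Sx => [y Sy|y].
  apply/subfield_of_setP; exists y%:P, 1.
  by split; rewrite ?polyOverC ?rpred1 // !hornerC ?oner_eq0 ?divr1.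
rewrite inE => /eqP->; apply/subfield_of_setP; exists 'X, 1.
by split; rewrite ?polyOverX ?rpred1 // ?hornerX hornerC ?oner_eq0 ?divr1.
Qed.

End Algebraic.

(** * Linear algebra over a subfield; finiteness of the algebraic part *)

Section FiniteSpan.
Variable U : fieldType.
Implicit Types (S : divringClosed U) (d : seq U) (x : U).

Definition span S d : set U :=
  [set x | exists c : nat -> U,
     (forall i, c i \in S) /\ x = \sum_(i < size d) c i * d`_i].

Definition dependent S m (e : 'I_m -> U) :=
  exists2 c : 'I_m -> U, forall i, c i \in S &
    (exists i, c i != 0) /\ \sum_i c i * e i = 0.

Lemma span_dependent S d m (e : 'I_m -> U) :
  (size d < m)%N -> (forall i, span S d (e i)) -> dependent S e.
Proof.
move=> lt_dm e_span.
have [c cP] := choice e_span.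
pose M i j := SubField ((cP i).1 j).
pose A := \matrix_(i < m, j < size d) M i j.
pose v := nz_row (kermx A).
have nzv : v != 0.
  rewrite nz_row_eq0 -mxrank_eq0 mxrank_ker -lt0n subn_gt0.
  by rewrite (leq_ltn_trans (rank_leq_col _)).
have vA : v *m A = 0 by apply/sub_kermxP/nz_row_sub.
exists (fun i => sub_field_val (v 0 i)) => [i|]; first exact: sub_field_valP.
split.
  have /rV0Pn[i vi] := nzv; exists i.
  by rewrite -(rmorph0 (@sub_field_val U S)) (inj_eq (@sub_field_val_inj _ _)).
have Ae i : e i = \sum_j sub_field_val (A i j) * d`_j.
  by have [_ ->] := cP i; apply: eq_bigr => j _; rewrite mxE.
under eq_bigr => i _ do rewrite Ae mulr_sumr.
rewrite exchange_big big1 // => j _ /=.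
under eq_bigr do rewrite mulrA -rmorphM.
rewrite -mulr_suml -rmorph_sum; have /matrixP/(_ 0 j) := vA.
by rewrite !mxE => ->; rewrite rmorph0 mul0r.
Qed.

(** A maximal independent family in [E] spans [E]. The spanning list is drawn from [E] itself, even
    when the bound [m] was found over a larger field. *)
Lemma dependent_span S (E : set U) m :
  (forall e : 'I_m -> U, (forall i, E (e i)) -> dependent S e) ->
  exists2 d : seq U, forall x, x \in d -> E x & E `<=` span S d.
Proof.
elim: m => [|m IHm] dep.
  have [i|c _ [[[]]]] // := dep (fun=> 0).
  by case: i.
have [/IHm//|] := pselect (forall e : 'I_m -> U, (forall i, E (e i)) -> dependent S e).
move=> /existsNP[e /not_implyP[Ee indep]].
exists [seq e i | i <- enum 'I_m] => [_ /mapP[i _ ->] //|x Ex].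
pose e' i := if unlift ord_max i is Some j then e j else x.
have [i|c Sc [[j nzcj] sum0]] := dep e'; first by rewrite /e'; case: unlift.
have e'l i : e' (lift ord_max i) = e i by rewrite /e' liftK.
have e'x : e' ord_max = x by rewrite /e' unlift_none.
move: sum0; rewrite (bigD1_ord ord_max) //= e'x.
under eq_bigr do rewrite e'l; move=> sum0.
(* Otherwise the relation would be one among the [e i] alone. *)
have nzc : c ord_max != 0.
  apply: contra_not_neq indep => c0.
  exists (fun i => c (lift ord_max i)) => //; split.
    case: (unliftP ord_max j) nzcj => [i -> nz|->]; first by exists i.
    by rewrite c0 eqxx.
  by rewrite -[RHS]sum0 c0 mul0r add0r.
pose b i := if insub i is Some j then - c (lift ord_max j) / c ord_max else 0.
exists b; split=> [i|].
  by rewrite /b; case: insubP => [k _ _|_]; rewrite ?rpred0 // rpred_div ?rpredN.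
rewrite size_map size_enum_ord.
have -> : x = - (\sum_(i < m) c (lift ord_max i) * e i) / c ord_max.
  apply: (canRL (mulfK nzc)); rewrite mulrC.
  by apply/eqP; rewrite -addr_eq0 sum0.
rewrite mulNr mulr_suml -sumrN; apply: eq_bigr => i _.
rewrite /b valK (nth_map i) ?size_enum_ord // nth_ord_enum.
by rewrite mulNr mulNr mulrAC.
Qed.

Lemma span_mem S d x : x \in d -> span S d x.
Proof.
move=> dx; exists (fun i => (i == index x d)%:R); split=> [i|]; first exact: rpred_nat.
have lt : (index x d < size d)%N by rewrite index_mem.
rewrite (bigD1 (Ordinal lt)) //= eqxx mul1r nth_index // big1 ?addr0 // => i.
by rewrite -val_eqE /= => /negPf->; rewrite mul0r.
Qed.

Lemma spanD S d x y : span S d x -> span S d y -> span S d (x + y).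
Proof.
move=> [c [Sc ->]] [b [Sb ->]]; exists (fun i => c i + b i).
split=> [i|]; first by rewrite rpredD.
by rewrite -big_split /=; apply: eq_bigr => i _; rewrite mulrDl.
Qed.

Lemma spanZ S d a x : a \in S -> span S d x -> span S d (a * x).
Proof.
move=> Sa [c [Sc ->]]; exists (fun i => a * c i).
split=> [i|]; first by rewrite rpredM.
by rewrite mulr_sumr; apply: eq_bigr => i _; rewrite mulrA.
Qed.

Lemma span_sum S d I (r : seq I) (F : I -> U) :
  (forall i, span S d (F i)) -> span S d (\sum_(i <- r) F i).
Proof.
move=> dF; elim/big_rec: _ => [|i x _]; last exact: spanD.
by exists (fun=> 0); split=> [i|]; rewrite ?rpred0 // big1 // => i _; rewrite mul0r.
Qed.

Lemma spanS S (T : divringClosed U) d x :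
  {subset S <= T} -> span S d x -> span T d x.
Proof. by move=> ST [c [Sc ->]]; exists c; split=> // i; apply/ST/Sc. Qed.

Lemma span_sub S d (T : divringClosed U) :
  {subset S <= T} -> {subset d <= T} -> forall x, span S d x -> x \in T.
Proof.
move=> ST dT _ [c [Sc ->]]; apply: rpred_sum => i _.
by apply: rpredM; [exact: ST|exact/dT/mem_nth].
Qed.

(** Write the annihilating polynomial as q X + c. If c is nonzero, q(x) x = -c exhibits the inverse;
    if c = 0, then q annihilates x as well. *)
Lemma inv_polyOver S x : x \in acl S -> x != 0 ->
  exists2 R : {poly U}, R \is a polyOver S & R.[x] = x^-1.
Proof.
move=> /aclP[P [nzP SP Px]] nzx; elim/poly_ind: P nzP SP Px => [|q c IHq].
  by rewrite eqxx.
move=> nzP SP Px.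
have Sq : q \is a polyOver S.
  apply/polyOverP => i; have /polyOverP/(_ i.+1) := SP.
  by rewrite coefD coefMX coefC addr0.
have Sc : c \in S.
  by have /polyOverP/(_ 0) := SP; rewrite coefD coefMX coefC add0r.
move: Px; rewrite rootE !hornerE; have [c0|nzc] := eqVneq c 0.
  rewrite c0 addr0 mulf_eq0 (negPf nzx) orbF => qx; apply: IHq => //.
  by apply: contraNneq nzP => ->; rewrite c0 mul0r addr0.
rewrite addr_eq0 => /eqP qx; exists (- c^-1 *: q).
  by rewrite polyOverZ ?rpredN ?rpredV.
apply: (mulIf nzx); rewrite hornerZ -mulrA qx mulrNN mulVf // mulVf //.
Qed.

(** A denominator r(t) is inverted by a polynomial in r(t), which turns every fraction into a
    polynomial in t; it is then reduced modulo [P]. *)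
Lemma algebraic_gen_span S t : t \in acl S ->
  exists n, forall x, x \in gen S [:: t] -> span S [seq t ^+ i | i <- iota 0 n] x.
Proof.
move=> St; have /aclP[P [nzP SP Pt]] := St.
exists (size P) => x /gen1_fraction[q [r [Sq Sr nzr ->]]].
have [R SR Rr] : exists2 R : {poly U}, R \is a polyOver S & R.[r.[t]] = r.[t]^-1.
  apply: inv_polyOver nzr.
  by apply: rpred_horner => //; apply: polyOverS Sr; apply: sub_acl.
have lift p : p \is a polyOver S -> exists Q, map_poly (@sub_field_val U S) Q = p.
  by apply: polyOver_lift => y /sub_field_valE.
have [P' PP'] := lift P SP.
have [|Q' QQ'] := lift (q * (R \Po r)); first by rewrite rpredM // polyOver_comp.
exists (fun i => (map_poly (@sub_field_val U S) (Q' %% P'))`_i).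
split=> [i|]; first by rewrite coef_map sub_field_valP.
rewrite size_map size_iota -Rr -horner_comp -hornerM -QQ'.
rewrite {1}(divp_eq Q' P') rmorphD rmorphM /= PP' hornerD hornerM (rootP Pt) mulr0 add0r.
rewrite (@horner_coef_wide _ (size P)); last first.
  rewrite size_map_poly -PP' size_map_poly ltnW // ltn_modp.
  by rewrite -(map_poly_eq0 (@sub_field_val U S)) PP'.
by apply: eq_bigr => i _; rewrite (nth_map 0) ?size_iota // nth_iota.
Qed.

(** Linear disjointness of S(t) and the algebraic closure of S: with denominators cleared, the
    relation is a polynomial in t with algebraic coefficients, hence zero, and each of its
    coefficients is a relation over S. *)
Lemma transcendental_dependent S t m (e : 'I_m -> U) :
    t \notin acl S -> (forall i, e i \in acl S) ->
  dependent (gen S [:: t]) e -> dependent S e.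
Proof.
move=> trt Se [c Sc [[j nzc] sum0]].
have [q qP] := choice (fun i => gen1_fraction (Sc i)).
have [r rP] := choice qP.
pose Q i := q i * \prod_(k < m | k != i) r k.
pose D := \prod_(k < m) (r k).[t].
have nzD : D != 0 by apply/prodf_neq0 => i _; have [] := rP i.
have SQ i : Q i \is a polyOver S.
  rewrite rpredM ?rpred_prod //; first by have [] := rP i.
  by move=> k _; have [] := rP k.
have Qt i : (Q i).[t] = c i * D.
  have [_ _ nzr ->] := rP i; rewrite hornerM horner_prod [D](bigD1 i) //=.
  by rewrite mulrA (divfK nzr).
pose W := \sum_i e i *: Q i.
have W0 : W = 0.
  apply: contraNeq trt => nzW; apply: (acl_root nzW).
    rewrite rpred_sum // => i _; apply: polyOverZ => //.
    by apply: polyOverS (SQ i); apply: sub_acl.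
  rewrite rootE horner_sum; under eq_bigr do rewrite hornerZ Qt mulrCA mulrA.
  by rewrite -mulr_suml sum0 mul0r.
have nzQ : Q j != 0.
  by apply: contraNneq (mulf_neq0 nzc nzD) => Q0; rewrite -Qt Q0 horner0.
(* At this index the [j]-th entry is the leading coefficient of [Q j], hence nonzero. *)
exists (fun i => (Q i)`_(size (Q j)).-1) => [i|]; first by apply/polyOverP.
split; first by exists j; rewrite -lead_coefE lead_coef_eq0.
have := congr1 (fun P : {poly U} => P`_(size (Q j)).-1) W0.
rewrite coef_sum coef0 => W0j; rewrite -[RHS]W0j.
by apply: eq_bigr => i _; rewrite coefZ mulrC.
Qed.

(** Generators are adjoined one at a time, with the induction hypothesis applied to the base S(t);
    no transcendence basis is chosen. *)
Theorem acl_gen_finite S s : exists2 d : seq U,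
  forall x, x \in d -> x \in acl S /\ x \in gen S s &
  forall x, x \in acl S -> x \in gen S s -> span S d x.
Proof.
elim: s S => [|t s IHs] S.
  exists [:: 1] => [x|x _ Sx].
    by rewrite inE => /eqP->; rewrite !rpred1.
  rewrite -[x]mulr1; apply: spanZ; last by apply: span_mem; rewrite mem_head.
  by apply: gen_min Sx.
have [d d_acl d_span] := IHs (gen S [:: t]).
have sub1 x : x \in acl S -> x \in gen S (t :: s) -> span (gen S [:: t]) d x.
  move=> Sx; rewrite gen_cons => sx; apply: d_span => //.
  by apply: aclS Sx; apply: sub_gen.
have [St|trt] := boolP (t \in acl S); last first.
  (* The list [d] spans over S(t) but need not be algebraic over S; only its length survives, as a
     bound on independent families over S. *)
  pose E := [set x | x \in acl S /\ x \in gen S (t :: s)].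
  have [|d' d'E Ed'] := @dependent_span S E (size d).+1.
    move=> e eE; apply: (transcendental_dependent trt) => [i|].
      by have [] := eE i.
    by apply: (span_dependent (leqnn _)) => i; have [? ?] := eE i; apply: sub1.
  by exists d' => [x /d'E//|x Sx sx]; apply: Ed'.
have [n nP] := algebraic_gen_span St.
have aclt : {subset gen S [:: t] <= acl S}.
  by apply: gen_min => [|x]; [exact: sub_acl|rewrite inE => /eqP->].
exists [seq x * y | x <- [seq t ^+ i | i <- iota 0 n], y <- d] => [x|x Sx sx].
  have tT : t \in gen S (t :: s) by apply/mem_gen/mem_head.
  move=> /allpairsPdep[_ [b [/mapP[i _ ->] /d_acl[b_acl b_gen] ->]]].
  split; rewrite rpredM ?rpredX // ?gen_cons //.
  have /aclP[P [nzP SP Px]] := b_acl; apply: acl_root nzP _ Px.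
  exact: polyOverS aclt _ SP.
have [c [Sc ->]] := sub1 x Sx sx; apply: span_sum => i.
have [b [Sb ->]] := nP _ (Sc i); rewrite mulr_suml; apply: span_sum => j.
rewrite -mulrA; apply: spanZ => //; apply: span_mem.
by apply: allpairs_f; rewrite mem_nth.
Qed.

End FiniteSpan.

(** * Iterative derivations *)

Definition idsub_closed (U : idFieldType) (L : idSubfield U) : divringClosed U :=
  GRing.DivringClosed.clone U (idsub_pred L) _.

Lemma idsub_closedP (U : idFieldType) (L : idSubfield U) x :
  x \in idsub_closed L <-> (L : set U) x.
Proof. by rewrite /in_mem /= /idsub_pred in_setE. Qed.

Section IterativeDerivations.
Variables (U : idFieldType) (p : nat).
Hypothesis charU : p \in [pchar U].
Implicit Types (L F K : idSubfield U) (x y t : U) (A B : set U).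

Let p_prime : prime p := pcharf_prime charU.
Let p_gt0 : (0 < p)%N := prime_gt0 p_prime.

Lemma ider_expp n x :
  ider n (x ^+ p) = if (p %| n)%N then ider (n %/ p) x ^+ p else 0.
Proof.
rewrite -[LHS]/(fpscoef (taylor (x ^+ p)) n) rmorphXn.
by rewrite fpscoef_expr_prime // (pcharf0 charU).
Qed.

Lemma ider_exppn i n x : ider (i * p ^ n) (x ^+ (p ^ n)) = ider i x ^+ (p ^ n).
Proof.
elim: n => [|n IHn]; first by rewrite muln1.
by rewrite expnSr mulnA !exprM ider_expp dvdn_mull // mulnK // IHn.
Qed.

Lemma ider_zero i : ider i (0 : U) = 0.
Proof. by have := iderB i (0 : U) 0; rewrite !subrr. Qed.

Lemma iderD i x y : ider i (x + y) = ider i x + ider i y.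
Proof. exact: (congr1 (@fpscoef U ^~ i) (rmorphD (@taylor U) x y)). Qed.

Lemma iderMn i x n : ider i (x *+ n) = ider i x *+ n.
Proof. by elim: n => [|n IHn]; rewrite ?ider_zero // !mulrS iderD IHn. Qed.

Lemma ider_nat_gt0 i n : (0 < i)%N -> ider i (n%:R : U) = 0.
Proof.
move=> i_gt0; rewrite -[LHS]/(fpscoef (taylor n%:R) i) rmorph_nat fpscoef_natmul.
by rewrite [fpscoef _ _]/= gtn_eqF // mul0rn.
Qed.

Lemma expp_inj n : injective (fun x : U => x ^+ (p ^ n)).
Proof.
move=> x y /= xy; apply/eqP; rewrite -subr_eq0.
have pn : [pchar U].-nat (p ^ n)%N by rewrite pnatX pnatE // charU.
have := exprDn_pchar (x - y) y pn; rewrite subrK xy -[LHS]add0r => /addIr/esym/eqP.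
by rewrite expf_eq0 => /andP[].
Qed.

(** Implicit differentiation of any order: in the Leibniz expansion the terms with [ider i y] add up
    to P'(y) times it, and all others involve lower derivatives of [y] and derivatives of
    coefficients. *)
Lemma ider_horner (T : divringClosed U) y i (P : {poly U}) :
    (0 < i)%N -> (forall l, (l < i)%N -> ider l y \in T) ->
    (forall l j, ider l P`_j \in T) ->
  (forall l, (l < i)%N -> ider l P.[y] \in T) /\
  ider i P.[y] - P^`().[y] * ider i y \in T.
Proof.
move=> i_gt0 Ty; elim/poly_ind: P => [|q c IHq] TP.
  by split=> [l _|]; rewrite ?deriv0 !horner0 ider_zero ?mul0r ?subr0 rpred0.
have Tq l j : ider l q`_j \in T.
  by have := TP l j.+1; rewrite coefD coefMX coefC addr0.
have Tc l : ider l c \in T.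
  by have := TP l 0; rewrite coefD coefMX coefC add0r.
have [Tql Tqi] := IHq Tq.
split=> [l lt_li|]; rewrite hornerMXaddC iderD iderM.
  rewrite rpredD // rpred_sum // => j _; rewrite rpredM ?Tql ?Ty //.
    exact: leq_ltn_trans (leq_ord j) lt_li.
  exact: leq_ltn_trans (leq_subr _ _) lt_li.
rewrite derivD derivM derivX derivC addr0 mulr1 !hornerE.
case: i i_gt0 Ty {IHq} Tql Tqi => // i _ Ty Tql Tqi.
rewrite big_ord_recl big_ord_recr /= !ider0 subn0 /bump /= add1n subnn ider0.
set m := \sum_(_ < _) _; set a := ider _ y; set b := ider _ q.[y].
have -> : q.[y] * a + (m + b * y) + ider i.+1 c - (q^`().[y] * y + q.[y]) * a =
    m + ider i.+1 c + (b - q^`().[y] * a) * y.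
  by ring.
rewrite rpredD ?rpredM //; last by have := Ty 0 isT; rewrite ider0.
rewrite rpredD // rpred_sum // => j _.
by rewrite rpredM // /bump /= add1n ?Tql ?Ty // ?ltnS // subSS leq_subr.
Qed.

(** If [x] is a multiple root of [P], then either P' is a shorter nonzero annihilator, or P' = 0 and
    [P] is a polynomial Q in X^p, with Q a shorter annihilator of x^p. *)
Lemma acl_separable_power (S : divringClosed U) x : x \in acl S ->
  exists n (Q : {poly U}), [/\ Q \is a polyOver S, root Q (x ^+ (p ^ n))
                             & Q^`().[x ^+ (p ^ n)] != 0].
Proof.
move=> /aclP[P [nzP SP Px]]; have [m] := ubnP (size P).
elim: m => // m IHm in P x nzP SP Px *; rewrite ltnS => le_Pm.
have [P'x|nzP'x] := eqVneq P^`().[x] 0; last by exists 0, P; rewrite expr1.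
have P_gt1 := root_size_gt1 nzP Px.
have [P'0|nzP'] := eqVneq P^`() 0; last first.
  apply: (IHm P^`()); rewrite ?polyOver_deriv //; first exact/eqP.
  by rewrite (leq_trans (lt_size_deriv nzP)).
(* This bound makes [Q] shorter than [P] and cuts nothing off, since i p >= [size P] whenever i >=
   [(size P).-1] >= 1. *)
pose Q := \poly_(i < (size P).-1) P`_(i * p).
have PQ : P = Q \Po 'X^p.
  apply/polyP => j; rewrite coef_comp_poly_Xn // coef_poly.
  have [pj|npj] := boolP (p %| j)%N.
    rewrite divnK //; case: ltnP => // le; rewrite nth_default //.
    rewrite -(divnK pj) -(prednK (ltnW P_gt1)).
    rewrite (leq_ltn_trans le) // ltn_Pmulr ?prime_gt1 //.
    by rewrite (leq_trans _ le) // -ltnS prednK // ltnW.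
  apply/eqP; case: j npj => [|j] npj; first by rewrite dvdn0 in npj.
  have /polyP/(_ j) := P'0; rewrite coef_deriv coef0 -mulr_natr => /eqP.
  by rewrite mulf_eq0 -(dvdn_pcharf charU) (negPf npj) orbF.
have [||||n [R [SR Rx R'x]]] := IHm Q (x ^+ p).
- by apply: contraNneq nzP; rewrite PQ => ->; rewrite comp_poly0.
- apply/polyOverP => i; rewrite coef_poly.
  by case: ifP; rewrite ?rpred0 // => _; apply/polyOverP.
- by move: Px; rewrite {1}PQ !rootE horner_comp hornerXn.
- by rewrite (leq_ltn_trans (size_poly _ _)) // prednK // ltnW.
by exists n.+1, R; rewrite expnS exprM.
Qed.

(** Implicit differentiation needs a simple root, so it is applied to y = x^(p^n); by [ider_exppn] a
    derivative of y is the p^n-th power of [ider i x], and [acl] is closed under roots. *)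
Lemma acl_ider F i (x : U) :
  x \in acl (idsub_closed F) -> ider i x \in acl (idsub_closed F).
Proof.
move=> /acl_separable_power[n [Q [FQ Qy nzQ'y]]].
apply: (@acl_exp _ _ _ (p ^ n)); first by rewrite expn_gt0 p_gt0.
rewrite -ider_exppn; move: (x ^+ _) Qy nzQ'y (_ * _)%N => y Qy nzQ'y {i}.
elim/ltn_ind => -[_|i IHi].
  rewrite ider0; apply: acl_root Qy; last exact: polyOverS (@sub_acl _ _) _ FQ.
  by apply: contraNneq nzQ'y => ->; rewrite deriv0 horner0.
have [l j|_] := @ider_horner (acl (idsub_closed F)) y i.+1 Q isT IHi.
  by apply/sub_acl/idsub_closedP/idsub_ider/idsub_closedP; apply/polyOverP.
rewrite (rootP Qy) ider_zero sub0r rpredN => TQ'y.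
rewrite -(mulKf nzQ'y (ider _ y)) rpredM ?rpredV //.
apply: rpred_horner; last by have := IHi 0 isT; rewrite ider0.
by rewrite polyOver_deriv //; apply: polyOverS (@sub_acl _ _) _ FQ.
Qed.

Lemma idgen_sub A : A `<=` idgen A.
Proof. by move=> x Ax L; apply. Qed.

Definition idgen_field A : idSubfield U.
Proof.
refine (@IDSubfield U (idgen A) _ _ _ _).
- by move=> L _; exact: idsub1.
- by move=> x y Ax Ay L AL; apply: idsubB; [exact: Ax|exact: Ay].
- by move=> x y Ax Ay L AL; apply: idsub_div; [exact: Ax|exact: Ay].
- by move=> i x Ax L AL; apply: idsub_ider; exact: Ax.
Defined.

Lemma idgen_min A L : A `<=` L -> idgen A `<=` L.
Proof. by move=> AL x; apply. Qed.

(** Perfectness of C: [ider (i * p)] of y^p is the p-th power of [ider i y], so p-th roots of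
    constants are constant. *)
Lemma constant_root x : (forall z, ider 1 z = 0 <-> exists y, z = y ^+ p) ->
  id_constants x -> exists2 y, id_constants y & x = y ^+ p.
Proof.
move=> rootU cx; have /rootU[y xy] := cx 1 isT.
exists y => // i i_gt0; apply/eqP; have := cx (i * p)%N; rewrite muln_gt0 i_gt0 p_gt0.
move=> /(_ isT)/eqP; rewrite xy ider_expp dvdn_mull // mulnK // expf_eq0.
by case/andP.
Qed.

Let d := ider 1 : U -> U.

Lemma iter_ider1 n x : iter n d x = ider n x *+ n`!.
Proof.
elim: n => [|n IHn]; first by rewrite ider0.
by rewrite iterS IHn /d iderMn ider_comp add1n bin1 -mulrnA factS mulnC.
Qed.

Lemma ider1M x y : d (x * y) = x * d y + d x * y.
Proof. by rewrite /d iderM big_ord_recl big_ord1 /= !ider0. Qed.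

Lemma ider1_constM x y : d x = 0 -> d (x * y) = x * d y.
Proof. by move=> dx; rewrite ider1M dx mul0r addr0. Qed.

Lemma ider1_constV x y : d y = 0 -> d (x / y) = d x / y.
Proof.
move=> dy; have [->|nzy] := eqVneq y 0; first by rewrite invr0 !mulr0 /d ider_zero.
apply: (mulIf nzy); rewrite divfK // -[in RHS](divfK nzy x).
by rewrite [RHS]ider1M dy mulr0 add0r.
Qed.

Lemma iter_ider1_constM n x y : d x = 0 -> iter n d (x * y) = x * iter n d y.
Proof. by move=> dx; elim: n => // n IHn; rewrite !iterS IHn ider1_constM. Qed.

Lemma iter_ider1D n x y : iter n d (x + y) = iter n d x + iter n d y.
Proof. by rewrite !iter_ider1 iderD mulrnDl. Qed.

Lemma iter_ider1_pow t n m : d t = 1 -> iter n d (t ^+ m) = t ^+ (m - n) *+ m ^_ n.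
Proof.
move=> dt; have d_pow k : d (t ^+ k) = t ^+ k.-1 *+ k.
  elim: k => [|k IHk]; first by rewrite expr0 mulr0n /d ider_1.
  rewrite exprS ider1M IHk dt mul1r; case: k {IHk} => [|k].
    by rewrite mulr0n mulr0 add0r.
  by rewrite mulrnAr -exprS -mulrSr.
elim: n => [|n IHn]; first by rewrite subn0.
rewrite iterS IHn -mulr_natl ider1_constM; last exact: ider_nat_gt0.
by rewrite d_pow mulr_natl -mulrnA ffactnSr mulnC subnS.
Qed.

Lemma fact_neq0 n : (n < p)%N -> (n`!)%:R != 0 :> U.
Proof.
move=> lt_np; rewrite -(dvdn_pcharf charU); elim: n lt_np => [|n IHn] lt_np.
  by rewrite dvdn1 neq_ltn prime_gt1 ?orbT.
rewrite factS Euclid_dvdM // negb_or IHn ?(ltnW lt_np) // andbT.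
by rewrite gtnNdvd.
Qed.

(** Let c be the last nonzero iterate of [ider 1] on [x]. It is killed by [ider 1], so the iterate
    before it, divided by c, has derivative 1. *)
Lemma exists_ider1_one K x : (K : set U) x -> d x != 0 ->
  exists2 t, (K : set U) t & d t = 1.
Proof.
move=> Kx nzdx.
have Kiter n : (K : set U) (iter n d x) by elim: n => // n IHn; exact: idsub_ider.
have nilp : exists n, iter n d x == 0.
  exists p; rewrite iter_ider1 -mulr_natr; case: p p_gt0 charU => // n _ ch.
  by rewrite factS natrM (pcharf0 ch) mul0r mulr0.
case: (ex_minnP nilp) => -[|[|m]] /eqP m0 m_min.
- by rewrite -[x]/(iter 0 d x) m0 /d ider_zero eqxx in nzdx.
- by rewrite -[d x]/(iter 1 d x) m0 eqxx in nzdx.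
have nzc : iter m.+1 d x != 0.
  by apply/eqP => c0; have := m_min m.+1; rewrite c0 eqxx ltnn => /(_ isT).
exists (iter m d x / iter m.+1 d x); first exact: idsub_div.
by rewrite ider1_constV // divff.
Qed.

(** The iterate of [ider 1] of top order isolates the top coefficient times a factorial, which is
    invertible below p; so the top terms vanish one by one. *)
Lemma span_ider1_eq (c : nat -> U) y t n : (n < p)%N -> d t = 1 ->
    (forall i, d (c i) = 0) -> d y = 0 ->
  y = \sum_(i < n.+1) c i * t ^+ i -> y = c 0.
Proof.
move=> lt_np dt dc dy; elim: n lt_np => [|n IHn] lt_np.
  by rewrite big_ord1 mulr1.
rewrite big_ord_recr /= => Ey; apply: (IHn (ltnW lt_np)).
suff cn0 : c n.+1 = 0 by rewrite {1}Ey cn0 mul0r addr0.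
have iter0 : iter n.+1 d 0 = 0 by rewrite iter_ider1 ider_zero mul0rn.
have : iter n.+1 d y = 0 by rewrite iterSr dy iter_ider1 ider_zero mul0rn.
rewrite Ey iter_ider1D (big_morph _ (@iter_ider1D n.+1) iter0) big1 => [|i _].
  rewrite add0r iter_ider1_constM // iter_ider1_pow // subnn ffactnn => /eqP.
  by rewrite mulf_eq0 (negPf (fact_neq0 lt_np)) orbF => /eqP.
by rewrite iter_ider1_constM // iter_ider1_pow // ffact_small // mulr0.
Qed.

(** * Closure of K<C> under p-th roots *)

Section RootClosed.
Variable K : idSubfield U.
Hypothesis rootU : forall z, ider 1 z = 0 <-> exists y, z = y ^+ p.
Hypothesis rootK : forall x, (K : set U) (x ^+ p) -> (K : set U) x.
Variable t : U.
Hypotheses (Kt : (K : set U) t) (dt : d t = 1).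

Let tpow := [seq t ^+ i | i <- iota 0 p].

Definition powers (M : idSubfield U) : divringClosed U.
Proof.
refine (@subfield_of_set U [set y | exists2 z, (M : set U) z & y = z ^+ p] _ _ _).
- by exists 1; rewrite ?expr1n //; apply: idsub1.
- move=> _ _ [a Ma ->] [b Mb ->]; exists (a - b); first exact: idsubB.
  by rewrite -!(pFrobenius_autE charU) rmorphB.
- move=> _ _ [a Ma ->] [b Mb ->]; exists (a / b); first exact: idsub_div.
  by rewrite exprMn exprVn.
Defined.

Lemma powersP M y : y \in powers M <-> exists2 z, (M : set U) z & y = z ^+ p.
Proof. exact: subfield_of_setP. Qed.

(** A Taylor expansion in [t]: the coefficient of t^n is the n-th iterate of [ider 1] over n!, a
    p-th power from [K], and subtracting this term lowers the order of nilpotency. *)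
Lemma span_tpow_nilpotent n x : (n <= p)%N -> (K : set U) x -> iter n d x = 0 ->
  span (powers K) tpow x.
Proof.
elim: n x => [|n IHn] x lt_np Kx dx0.
  by rewrite -[x]/(iter 0 d x) dx0 -(mul0r 1); apply: spanZ; rewrite ?rpred0 //;
     apply: span_mem; apply/mapP; exists 0; rewrite ?mem_iota.
have Knat m : (K : set U) m%:R by apply/idsub_closedP; rewrite rpred_nat.
have nzf := fact_neq0 lt_np.
have df m : d m%:R = 0 by exact: ider_nat_gt0.
pose y := iter n d x / n`!%:R.
have Ky : (K : set U) y.
  by apply: idsub_div => //; rewrite iter_ider1; apply/idsub_closedP;
     rewrite rpredMn //; apply/idsub_closedP/idsub_ider.
have dy : d y = 0 by rewrite ider1_constV // -iterS dx0 mul0r.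
have /rootU[z Ez] := dy.
have Kz : (K : set U) z by apply: rootK; rewrite -Ez.
have py : y \in powers K by apply/powersP; exists z.
have tn : span (powers K) tpow (y * t ^+ n).
  apply: spanZ => //; apply: span_mem; apply/mapP; exists n => //.
  by rewrite mem_iota.
rewrite -[x](subrK (y * t ^+ n)); apply: spanD => //; apply: IHn (ltnW lt_np) _ _.
  apply: idsubB => //; apply/idsub_closedP/rpredM; first exact/idsub_closedP.
  exact/rpredX/idsub_closedP.
rewrite -mulNr iter_ider1D iter_ider1_constM; last first.
  by rewrite -sub0r /d iderB ider_zero -/d dy subrr.
by rewrite iter_ider1_pow // subnn ffactnn mulNr divfK // subrr.
Qed.

Lemma span_tpow x : (K : set U) x -> span (powers K) tpow x.
Proof.
move=> Kx; apply: (span_tpow_nilpotent (leqnn p) Kx).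
rewrite iter_ider1 -mulr_natr; case: p p_gt0 charU => // n _ ch.
by rewrite factS natrM (pcharf0 ch) mul0r mulr0.
Qed.

Let M := idgen_field ((K : set U) `|` @id_constants U).

Let KM : (K : set U) `<=` M.
Proof. by move=> x Kx; apply: idgen_sub; left. Qed.

(** This will turn out to be all of [M]: it contains K by [span_tpow], and C because C = C^p, so it
    is enough that it is an ID-subfield. *)
Let N : set U := span (powers M) tpow.

Let KN : (K : set U) `<=` N.
Proof.
move=> x /span_tpow; apply: spanS => _ /powersP[z Kz ->].
by apply/powersP; exists z => //; apply: KM.
Qed.

Let N_sub : N `<=` M.
Proof.
move=> x Nx; apply/idsub_closedP; apply: span_sub Nx => [y /powersP[z Mz ->]|].
  by rewrite rpredX //; apply/idsub_closedP.
by move=> _ /mapP[i _ ->]; rewrite rpredX //; apply/idsub_closedP/KM.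
Qed.

Let N_powers x : x \in powers M -> N x.
Proof.
move=> Mx; rewrite -[x]mulr1; apply: spanZ => //; apply/KN/idsub1.
Qed.

Let NM x y : N x -> N y -> N (x * y).
Proof.
have tN z i : N z -> N (t ^+ i * z).
  move=> [c [Mc ->]]; rewrite mulr_sumr; apply: span_sum => j.
  rewrite mulrCA; apply: spanZ => //.
  rewrite (nth_map 0); last by rewrite -(size_map (fun i => t ^+ i)).
  by rewrite -exprD; apply/KN/idsub_closedP; rewrite rpredX //; apply/idsub_closedP.
move=> [c [Mc ->]] Ny; rewrite mulr_suml; apply: span_sum => j.
rewrite -mulrA; apply: spanZ => //.
rewrite (nth_map 0); last by rewrite -(size_map (fun i => t ^+ i)).
exact: tN.
Qed.

(** Derivatives of p-th powers are p-th powers or 0, so the coefficients stay in M^p; derivatives of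
    powers of [t] stay in [K]. *)
Let N_ider i x : N x -> N (ider i x).
Proof.
move=> [c [Mc ->]]; rewrite (big_morph _ (@iderD i) (ider_zero i)).
apply: span_sum => j; rewrite iderM; apply: span_sum => l; apply: spanZ.
  have /powersP[z Mz ->] := Mc j; rewrite ider_expp; case: ifP => _; last exact: rpred0.
  by apply/powersP; exists (ider (l %/ p) z) => //; apply: idsub_ider.
rewrite (nth_map 0); last by rewrite -(size_map (fun i => t ^+ i)).
by apply/KN/idsub_ider/idsub_closedP; rewrite rpredX //; apply/idsub_closedP.
Qed.

Definition idsub_span : idSubfield U.
Proof.
refine (@IDSubfield U N _ _ _ N_ider).
- exact/KN/idsub1.
- move=> x y Nx Ny; rewrite -mulN1r; apply: spanD => //.
  by apply: spanZ => //; rewrite rpredN1.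
- move=> x y Nx Ny; have [->|nzy] := eqVneq y 0.
    by rewrite invr0 mulr0; apply: N_powers; rewrite rpred0.
  (* The only denominator left is y^p, which lies in M^p because [N] is contained in [M]. *)
  apply: NM => //; have -> : y^-1 = (y ^+ p)^-1 * y ^+ p.-1.
    by rewrite -[in (_ ^+ p)^-1](prednK p_gt0) exprS invfM divfK // expf_neq0.
  apply: NM.
    by apply: N_powers; rewrite rpredV; apply/powersP; exists y => //; apply: N_sub.
  elim: p.-1 => [|n IHn]; first exact: (KN (idsub1 K)).
  by rewrite exprS; apply: NM.
Defined.

(** Expand x^p along the powers of [t] with coefficients in M^p. Both x^p and the coefficients are
    killed by [ider 1], so x^p equals [c 0], the p-th power of an element of M, and Frobenius is
    injective. *)
Lemma adjoin_constants_root x :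
  idgen ((K : set U) `|` @id_constants U) (x ^+ p) ->
  idgen ((K : set U) `|` @id_constants U) x.
Proof.
move=> Mxp; have [c [Mc Ex]] : N (x ^+ p).
  apply: (@idgen_min _ idsub_span _ _ Mxp) => y [/KN//|].
  move=> /(constant_root rootU)[z cz ->]; apply: N_powers.
  by apply/powersP; exists z => //; apply: idgen_sub; right.
have dMc i : d (c i) = 0.
  by have /powersP[z _ ->] := Mc i; apply/rootU; exists z.
move: Ex; rewrite size_map size_iota => Ex.
have [z Mz /eqP Ez] : exists2 z, (M : set U) z & x ^+ p = z ^+ p.
  have /powersP[z Mz Ez] := Mc 0; exists z => //; rewrite -Ez.
  apply: (@span_ider1_eq c _ t p.-1) => //; first by rewrite prednK.
    by apply/rootU; exists x.
  rewrite prednK // [LHS]Ex; apply: eq_bigr => i _.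
  by rewrite (nth_map 0) ?size_iota // nth_iota.
by have /(@expp_inj 1)-> : x ^+ (p ^ 1) = z ^+ (p ^ 1) by apply/eqP.
Qed.

End RootClosed.

End IterativeDerivations.

(** * Points of group varieties and logarithmic derivatives *)

Section GroupLaws.
Variables (k : fieldType) (G : algGroup k) (R : calg k).
Implicit Types x y : G R.

Lemma ag_mulKV x y : ag_mul (ag_inv x) (ag_mul x y) = y.
Proof. by rewrite ag_mulA ag_mulV ag_mul1. Qed.

Lemma ag_mulrV x : ag_mul x (ag_inv x) = ag_one G R.
Proof.
rewrite -[LHS]ag_mul1 -[X in ag_mul X _](ag_mulV (ag_inv x)).
by rewrite -ag_mulA [X in ag_mul _ X]ag_mulA ag_mulV ag_mul1 ag_mulV.
Qed.

Lemma ag_mulr1 x : ag_mul x (ag_one G R) = x.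
Proof. by rewrite -(ag_mulV x) ag_mulA ag_mulrV ag_mul1. Qed.

Lemma ag_mulK x y : ag_mul (ag_mul y (ag_inv x)) x = y.
Proof. by rewrite -ag_mulA ag_mulV ag_mulr1. Qed.

End GroupLaws.

Section ArcBundles.
Variables (k : fieldType) (G : algGroup k).

Lemma arc_h_nat (R S : calg k) (g : calg_hom R S) (x : arc_bundle G R) :
  arc_h (arc_map g x) = arc_map g (arc_h x).
Proof.
rewrite /arc_h /arc_map ag_mul_nat ag_inv_nat; congr (ag_mul _ (ag_inv _)).
rewrite /arc_sect /arc_proj -!kmapK; apply: kmap_eq => y.
by apply: fpsP => -[|i] /=; rewrite ?rmorph0.
Qed.

Lemma arc_sect_nat (X : kfunctor k) (R S : calg k) (g : calg_hom R S) (x : X R) :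
  arc_map g (arc_sect x) = arc_sect (kmap g x).
Proof.
by apply: kmap_square => y; apply: fpsP => -[|i] /=; rewrite ?rmorph0.
Qed.

(** The locus where two points agree is closed, cut out by an ideal [I]; if an injective [g] kills
    [I], then I is zero. *)
Lemma kmap_inj (X : kfunctor k) (R S : calg k) (g : calg_hom R S) :
  separated X -> injective g -> injective (@kmap k X R S g).
Proof.
move=> sepX g_inj x y exy; have [I IP] := sepX R x y.
rewrite -[x](@kmap_id k X R (calg_id R)) // -[y](@kmap_id k X R (calg_id R)) //.
have /IP gI := exy.
by apply/IP => r /gI gr; apply: g_inj; rewrite rmorph0.
Qed.

End ArcBundles.

Lemma fps_map_inj (R S : comPzRingType) (f : {rmorphism R -> S}) :
  injective f -> injective (fps_map f).
Proof.
move=> f_inj x y exy; apply: fpsP => i; apply: f_inj.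
exact: (congr1 (@fpscoef S ^~ i) exy).
Qed.

Section UniversalPoints.
Variables (U : idFieldType) (F : idSubfield U).
Let k : fieldType := idsub_type (constants F).
Let UA : calg k := univ_alg F.

(** * Points over a subfield and their coordinates *)

Section Coordinates.
Variables (E : calg k) (j : calg_hom E UA).
Hypothesis j_unit : forall r, j r != 0 -> exists s, s * r = 1.

Lemma coordinates_kmap (X : kfunctor k) (z : X E) b :
  coordinates (kmap j z) b -> exists y, j y = b.
Proof.
move=> [A [u [f [c [ou fu ->]]]]].
have [g _ jg] := @affine_open_factor k X A E UA u j U idfun z f ou j_unit fu.
exists (g c); exact: jg.
Qed.

(** The arc [w] enters the chart already over E[[epsilon]], where a series with invertible constant
    term is a unit; so the Taylor series of each chart coordinate has coefficients in [E]. *)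
Lemma taylor_lift (X : kfunctor k) (A : calg k) (u : X A) (f : calg_hom A UA)
    (w : arc_bundle X E) : affine_open u ->
  nabla (kmap f u) = arc_map j w ->
  forall c i, exists y, j y = ider i (f c).
Proof.
move=> ou fu c i.
have [r r0||g _ gP] := @affine_open_factor k X A (fps_alg E) (fps_alg UA) u
  (fps_map_hom j) U (@fps_eval0 U) w (calg_comp (taylor_hom F) f) ou.
- by have [s /fps_unit] := j_unit r0.
- by rewrite kmapK.
by exists (fpscoef (g c) i); have := congr1 (@fpscoef U ^~ i) (gP c).
Qed.

Lemma coordinates_lift (X : kfunctor k) (a : X UA) :
    is_variety X -> injective j ->
  (forall b, coordinates a b -> exists y, j y = b) -> exists z, kmap j z = a.
Proof.
move=> [_ _ [n [A [u [chart cover]]]]] j_inj aE.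
have [i [f fu]] := cover U (@idsub_val U (constants F)) a.
have [ou _ _] := chart i.
have [c|g jg] := @calg_hom_lift k (A i) E UA j f j_inj.
  by apply: aE; exists (A i), (u i), f, c; split; [exact: ou|exact: fu|].
exists (kmap g (u i)); rewrite -kmapK -[RHS]fu; exact: kmap_eq.
Qed.

End Coordinates.

Lemma finite_chart (X : kfunctor k) (a : X UA) : is_variety X ->
  exists (A : calg k) (u : X A) (f : calg_hom A UA) (s : seq U),
    [/\ affine_open u, kmap f u = a, forall x, x \in s -> exists c, f c = x &
        forall T : divringClosed U, {subset idsub_closed (constants F) <= T} ->
          forall c, f c \in gen T s].
Proof.
move=> [_ _ [n [A [u [chart cover]]]]].
have [i [f fu]] := cover U (@idsub_val U (constants F)) a.
have [ou [m [t genA]] _] := chart i.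
exists (A i), (u i), f, [seq f (t l) | l <- enum 'I_m]; split=> //.
  by move=> _ /mapP[l _ ->]; exists (t l).
move=> T CT c; pose B := [set c | f c \in gen T [seq f (t l) | l <- enum 'I_m]].
suff : B c by [].
rewrite (genA B) // => [d|l|x y Bx By|x y Bx By]; rewrite /B /mkset.
- by rewrite calg_homP; apply/sub_gen/CT/idsub_closedP/idsub_valP.
- by apply: mem_gen; apply: map_f; rewrite mem_enum.
- by rewrite rmorphD; apply: rpredD.
- by rewrite rmorphM; apply: rpredM.
Qed.

(** Presents [T] as an algebra over C_F embedded in [U], so that points over [T] make sense. *)
Lemma subalgebra (T : divringClosed U) :
    {subset idsub_closed (constants F) <= T} ->
  exists (E : calg k) (j : calg_hom E UA),
    [/\ injective j, forall x, x \in T <-> exists y, j y = x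
      & forall r, j r != 0 -> exists s, s * r = 1].
Proof.
move=> CT.
have [x|str strP] := @rmorph_lift k (sub_field T) U (@sub_field_val U T)
  (@idsub_val U (constants F)) (@sub_field_val_inj _ _).
  by apply/sub_field_valE/CT/idsub_closedP/idsub_valP.
exists (CAlg str), (@CAlgHom k (CAlg str) UA (@sub_field_val U T) strP).
split=> [|x|r /= nzr]; [exact: sub_field_val_inj|exact: sub_field_valE|].
by exists r^-1; rewrite mulVf.
Qed.

Lemma logderE (G : algGroup k) (g : G UA) :
  logder g = ag_mul (nabla g) (ag_inv (arc_sect g)).
Proof.
rewrite /logder /arc_h; congr (ag_mul _ (ag_inv (arc_sect _))).
rewrite /arc_proj /nabla -kmapK (kmap_id (f := calg_comp _ _)) //.
by move=> x /=; rewrite /fps_eval0 /= ider0.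
Qed.

Lemma nablaE (G : algGroup k) (g : G UA) :
  nabla g = ag_mul (logder g) (arc_sect g).
Proof. by rewrite logderE ag_mulK. Qed.

(** [nabla] is multiplicative and nabla(h) = nabla(g) s(g)^-1 s(h), so [nabla] and s agree on g^-1
    h. A chart being a monomorphism, the coordinates then have constant Taylor series. *)
Lemma logder_eq_constant (G : algGroup k) (g h : G UA) : logder g = logder h ->
  coordinates (ag_mul (ag_inv g) h) `<=` @id_constants U.
Proof.
move=> gh _ [A [u [f [c [[u_mono _] fu ->]]]]].
suff e : kmap (taylor_hom F) (kmap f u) = kmap (fpsC_hom UA) (kmap f u).
  apply/id_constantsP.
  apply: (u_mono _ (calg_comp (taylor_hom F) f) (calg_comp (fpsC_hom UA) f)).
  by rewrite !kmapK.
rewrite fu !ag_mul_nat !ag_inv_nat -/(nabla g) -/(nabla h).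
rewrite (nablaE h) -gh logderE -(ag_mulA (nabla g)) ag_mulKV.
by [].
Qed.

End UniversalPoints.

(** * Galois extensions are strongly normal *)

Section GeneratedDerivations.
Variables (U : idFieldType) (S : divringClosed U) (s : seq U).
Hypothesis S_ider : forall i x, x \in S -> ider i x \in gen S s.
Hypothesis s_ider : forall i x, x \in s -> ider i x \in gen S s.

Let stable : set U := [set x | forall i, ider i x \in gen S s].

(** The Leibniz rule for x x^-1 = 1 is solved for the derivative of order i of x^-1 in terms of
    lower ones. *)
Fact stableV (x : U) : stable x -> stable x^-1.
Proof.
have [->|nzx] := eqVneq x 0; first by rewrite invr0.
move=> sx; elim/ltn_ind => i IHi.
have xV : x^-1 \in gen S s by rewrite rpredV; have := sx 0; rewrite ider0.
have := iderM i x x^-1; rewrite divff // big_ord_recl subn0 ider0 ider_1.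
move/esym/(canRL (addrK _))/(canRL (mulKf nzx)) => ->.
rewrite rpredM ?rpredV //; first by have := sx 0; rewrite ider0.
rewrite rpredB ?rpred_nat // rpred_sum // => j _; rewrite rpredM //.
by apply: IHi; rewrite lift0 ltn_subrL (leq_ltn_trans _ (ltn_ord j)).
Qed.

Fact stable_div (x y : U) : stable x -> stable y -> stable (x / y).
Proof.
move=> sx /stableV sy i; rewrite iderM rpred_sum // => j _.
by apply: rpredM; [exact: sx|exact: sy].
Qed.

Lemma gen_ider i x : x \in gen S s -> ider i x \in gen S s.
Proof.
pose T := @subfield_of_set U stable
  (fun i => (S_ider i (rpred1 S) : ider i 1 \in gen S s))
  (fun x y sx sy i => eq_ind_r (fun z => z \in gen S s)
     (rpredB (sx i) (sy i)) (iderB i x y))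
  stable_div.
have sub : {subset gen S s <= T}.
  apply: gen_min => y y_in; apply/subfield_of_setP => l.
    exact: S_ider.
  exact: s_ider.
by move=> /sub/subfield_of_setP; apply.
Qed.

End GeneratedDerivations.

Section GaloisExtension.
Variables (p : nat) (U : idFieldType) (F K : idSubfield U).
Hypothesis charU : p \in [pchar U].
Hypothesis rootU : forall x : U, ider 1 x = 0 <-> exists y, x = y ^+ p.
Let k : fieldType := idsub_type (constants F).
Let UA : calg k := univ_alg F.
Variables (G : algGroup k) (alpha : arc_bundle G (base_alg F)) (a : G UA).
Hypothesis a_sol : logder a = arc_map (base_univ_hom F) alpha.
Hypothesis K_gen :
  K = proot_closure p (idgen ((F : set U) `|` coordinates a)) :> set U.

Let S := idsub_closed F.

Let constS : {subset idsub_closed (constants F) <= S}.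
Proof. by move=> x /idsub_closedP[Fx _]; apply/idsub_closedP. Qed.

(** The list consists of the coordinates of a in one chart. Once F(s) is stable under the
    derivations, it is both F<a> and F<s>. *)
Lemma finite_generation : exists s : seq U,
  [/\ forall i x, x \in gen S s -> ider i x \in gen S s,
      idgen ((F : set U) `|` coordinates a) = [set x | x \in gen S s]
    & idgen ((F : set U) `|` [set` s]) = [set x | x \in gen S s]].
Proof.
have [A [u [f [s [ou fu sf genf]]]]] := finite_chart a (ag_varietyP G).
have FT : {subset S <= gen S s} := @sub_gen _ _ _.
have CT : {subset idsub_closed (constants F) <= gen S s}.
  by move=> x /constS/FT.
have [E [j [j_inj jP j_unit]]] := subalgebra CT.
have [c|g jg] := @calg_hom_lift k A E UA j f j_inj; first exact/jP/genf.
have az : kmap j (kmap g u) = a.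
  by rewrite -kmapK -[RHS]fu; apply: kmap_eq.
have coordT b : coordinates a b -> b \in gen S s.
  by rewrite -az => /(coordinates_kmap j_unit)/jP.
have [c|i jFE] := @calg_hom_lift k (base_alg F) E UA j (base_univ_hom F) j_inj.
  exact/jP/FT/idsub_closedP/idsub_valP.
(* The logarithmic equation read over E = F(s): its right-hand side is an arc over [E], as
   [taylor_lift] requires. *)
have aw : nabla (kmap f u) =
    arc_map j (ag_mul (arc_map i alpha) (arc_sect (kmap g u))).
  rewrite /arc_map ag_mul_nat -!/(arc_map _ _) arc_sect_nat az fu nablaE a_sol.
  congr (ag_mul _ _); rewrite /arc_map -kmapK; apply: kmap_eq => x.
  by apply: fpsP => n /=; rewrite jFE.
have T_ider n x : x \in gen S s -> ider n x \in gen S s.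
  apply: gen_ider => [l y Sy|l y /sf[c <-]].
    by apply/FT/idsub_closedP/idsub_ider/idsub_closedP.
  exact/jP/(taylor_lift j_unit ou aw).
have T_idgen (A' : set U) : (F : set U) `<=` A' -> [set` s] `<=` A' ->
    (forall x, A' x -> x \in gen S s) -> idgen A' = [set x | x \in gen S s].
  move=> FA sA AT; apply/seteqP; split=> [|x].
    pose T := @IDSubfield U [set x | x \in gen S s] (rpred1 _) (@rpredB _ _)
      (@rpred_div _ _) T_ider.
    exact: (@idgen_min _ _ T).
  move=> Tx; apply/(idsub_closedP (idgen_field A')).
  apply: gen_min Tx => y.
    by move=> /idsub_closedP/FA Ay; apply/idsub_closedP/idgen_sub.
  by move=> sy; apply/idsub_closedP/idgen_sub/sA.
exists s; split=> //; apply: T_idgen.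
- by move=> x Fx; left.
- by move=> x /sf[c <-]; right; exists A, u, f, c.
- by move=> x [Fx|/coordT//]; apply/FT/idsub_closedP.
- by move=> x Fx; left.
- by move=> x sx; right.
- by move=> x [Fx|]; [apply/FT/idsub_closedP|exact: mem_gen].
Qed.

Let rootK x n : (K : set U) (x ^+ (p ^ n)) -> (K : set U) x.
Proof. by rewrite K_gen => -[m xm]; exists (n + m)%N; rewrite expnD exprM. Qed.

Let FK : (F : set U) `<=` K.
Proof.
by move=> x Fx; rewrite K_gen; exists 0; rewrite expr1; apply: idgen_sub; left.
Qed.

Let aK b : coordinates a b -> (K : set U) b.
Proof.
by move=> ab; rewrite K_gen; exists 0; rewrite expr1; apply: idgen_sub; right.
Qed.

Lemma galois_finitely_generated : exists b : seq U,
  K = proot_closure p (idgen ((F : set U) `|` [set` b])) :> set U.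
Proof. by have [s [_ E1 E2]] := finite_generation; exists s; rewrite K_gen E1 E2. Qed.

Lemma rel_alg_closureE x : rel_alg_closure F x <-> x \in acl S.
Proof.
apply: iff_trans (iff_sym (aclP S x)); apply: algebraicOverP => y.
split=> [/idsub_closedP Fy|[z <-]]; first by exists (idsub_mk Fy).
exact/idsub_closedP/idsub_valP.
Qed.

(** The algebraic part of F<a> is an ID-field spanned over F by a finite list, which therefore
    generates it. Taking p-power roots commutes with this intersection, since the algebraic closure
    is closed under roots. *)
Lemma galois_algebraic_part : exists d : seq U,
  rel_alg_closure F `&` K =
  proot_closure p (idgen ((F : set U) `|` [set` d])) :> set U.
Proof.
have [s [T_ider E1 _]] := finite_generation.
have [d dP d_span] := acl_gen_finite S s; exists d.
have -> : idgen ((F : set U) `|` [set` d]) =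
    [set x | x \in acl S /\ x \in gen S s].
  apply/seteqP; split=> x.
    have sub1 : 1 \in acl S /\ 1 \in gen S s by rewrite !rpred1.
    pose E := @IDSubfield U [set x | x \in acl S /\ x \in gen S s] sub1
      (fun x y ex ey => conj (rpredB ex.1 ey.1) (rpredB ex.2 ey.2))
      (fun x y ex ey => conj (rpred_div ex.1 ey.1) (rpred_div ex.2 ey.2))
      (fun i x ex => conj (acl_ider charU i ex.1) (T_ider i x ex.2)).
    apply: (@idgen_min _ _ E) => y [/idsub_closedP Sy|]; last exact: dP.
    by split; [exact: sub_acl|exact: sub_gen].
  move=> [Sx sx]; apply/(idsub_closedP (idgen_field _)).
  apply: span_sub (d_span x Sx sx) => y; last first.
    by move=> dy; apply/idsub_closedP/idgen_sub; right.
  by move=> /idsub_closedP Fy; apply/idsub_closedP/idgen_sub; left.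
apply/seteqP; split=> x.
  move=> [/rel_alg_closureE Sx]; rewrite K_gen E1 => -[n sx].
  by exists n; split=> //; rewrite rpredX.
move=> [n [Sx sx]]; split; last by rewrite K_gen E1; exists n.
apply: (rel_alg_closureE x).2; apply: acl_exp Sx.
by rewrite expn_gt0 prime_gt0 ?(pcharf_prime charU).
Qed.

Let CK : (constants F : set U) `<=` K.
Proof. by move=> x [Fx _]; apply: FK. Qed.

Let KA : calg k := @CAlg k (idsub_type K) (idsub_incl CK).

Let jK : calg_hom KA UA := @CAlgHom k KA UA (@idsub_val U K) (fun=> erefl).

Let iFK : calg_hom (base_alg F) KA.
Proof.
by refine (@CAlgHom k (base_alg F) KA (idsub_incl FK) _) => c; apply: idsub_val_inj.
Defined.

(** Taylor series inside [K], so that the arc of a point over [K] has coefficients to which an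
    embedding of [K] can be applied. *)
Let taylorK : calg_hom KA (fps_alg KA).
Proof.
refine (@CAlgHom k KA (fps_alg KA) (@taylor (idsub_type K)) _) => c.
apply: (fps_map_inj (@idsub_val_inj U K)); apply: fpsP => i.
have := congr1 (@fpscoef U ^~ i) ((id_constantsP _).1 (idsub_valP c).2).
by move=> /= ->; case: i => //=; rewrite rmorph0.
Defined.

(** * Embeddings of K over F *)

Section Embedding.
Variable sigma : {rmorphism idsub_type K -> U}.
Hypothesis sigmaP : id_embedding_over F sigma.

Fact sigma_homP c : sigma (calg_str KA c) = calg_str UA c.
Proof. by apply: sigmaP.2; exact: (idsub_valP c).1. Qed.

Let sigmaA : calg_hom KA UA := @CAlgHom k KA UA sigma sigma_homP.

(** The logarithmic derivative of [z] computed over [K] is alpha, because this holds over [U] and G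
    is separated; sigma commutes with the derivations and fixes alpha. *)
Lemma logder_embedding (z : G KA) :
  kmap jK z = a -> logder (kmap sigmaA z) = logder a.
Proof.
move=> za; have [_ sepG _] := ag_varietyP G.
have logder_nat (h : calg_hom KA UA) : (forall i x, h (ider i x) = ider i (h x)) ->
    logder (kmap h z) = arc_map h (arc_h (kmap taylorK z)).
  move=> hP; rewrite -arc_h_nat; congr (arc_h _).
  by apply: kmap_square => x; apply: fpsP => i /=; rewrite hP.
have alphaK : arc_h (kmap taylorK z) = arc_map iFK alpha.
  apply: (@kmap_inj k G (fps_alg KA) (fps_alg UA) (fps_map_hom jK)) => //.
    exact/fps_map_inj/idsub_val_inj.
  rewrite -/(arc_map jK _) -logder_nat // za a_sol /arc_map -kmapK.
  by apply: kmap_eq => x; apply: fpsP.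
rewrite (logder_nat sigmaA sigmaP.1) alphaK a_sol /arc_map -kmapK.
apply: kmap_eq => x; apply: fpsP => i /=.
by rewrite sigmaP.2 //; apply: idsub_valP.
Qed.

Lemma galois_embedding_image : nontrivial_idfield K ->
  range sigma `<=` idgen ((K : set U) `|` @id_constants U).
Proof.
move=> [x0 Kx0 dx0].
pose M := idgen_field ((K : set U) `|` @id_constants U).
have KM : (K : set U) `<=` M by move=> x Kx; apply: idgen_sub; left.
have jK_unit r : jK r != 0 -> exists s, s * r = 1.
  by move=> nzr; exists r^-1; rewrite mulVf.
have [b ab|z za] := @coordinates_lift U F KA jK G a (ag_varietyP G) (@idsub_val_inj _ _).
  by exists (idsub_mk (aK ab)).
have sa_log := logder_embedding za.
pose sa := kmap sigmaA z.
have saM b : coordinates sa b -> (M : set U) b.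
  have CM : {subset idsub_closed (constants F) <= idsub_closed M}.
    by move=> x /idsub_closedP[Fx _]; apply/idsub_closedP/KM/FK.
  have [E [j [j_inj jP j_unit]]] := subalgebra CM.
  have lift := @coordinates_lift U F E j G _ (ag_varietyP G) j_inj.
  have [c ac|za' za'E] := lift a.
    exact/jP/idsub_closedP/KM/aK.
  have [c cc|zc zcE] := lift (ag_mul (ag_inv a) sa).
    apply/jP/idsub_closedP/idgen_sub; right.
    by apply: logder_eq_constant cc.
  have <- : kmap j (ag_mul za' zc) = sa.
    by rewrite ag_mul_nat za'E zcE ag_mulA ag_mulrV ag_mul1.
  by move=> /(coordinates_kmap j_unit)/jP/idsub_closedP.
(* The part of [K] that sigma maps into [M], taken as a subset of [U] so that minimality of F<a>
   applies to it. *)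
pose P := [set x : U | exists2 y : idsub_type K, idsub_val y = x & (M : set U) (sigma y)].
have P1 : P 1 by exists 1; rewrite ?rmorph1 //; apply: idsub1.
have PB x y : P x -> P y -> P (x - y).
  by move=> [x' <- Mx] [y' <- My]; exists (x' - y'); rewrite rmorphB //; apply: idsubB.
have Pdiv x y : P x -> P y -> P (x / y).
  by move=> [x' <- Mx] [y' <- My]; exists (x' / y');
    rewrite fmorph_div //; apply: idsub_div.
have Pider i x : P x -> P (ider i x).
  by move=> [x' <- Mx]; exists (ider i x') => //; rewrite sigmaP.1; apply: idsub_ider.
have aP : idgen ((F : set U) `|` coordinates a) `<=` P.
  apply: (@idgen_min _ _ (IDSubfield P1 PB Pdiv Pider)) => b [Fb|].
    exists (idsub_mk (FK Fb)) => //; rewrite sigmaP.2 //; exact/KM/FK.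
  rewrite -{1}za => -[A [u [f [c [ou fu ->]]]]].
  have [g gz jg] := @affine_open_factor k G A KA UA u jK U idfun z f ou jK_unit fu.
  exists (g c); first exact: jg.
  apply: saM; exists A, u, (calg_comp sigmaA g), c; split=> //.
  by rewrite kmapK gz.
have [t Kt dt] := exists_ider1_one charU Kx0 dx0.
have rootM x : (M : set U) (x ^+ p) -> (M : set U) x.
  apply: (adjoin_constants_root charU rootU _ Kt dt) => y.
  by rewrite -[p]expn1; apply: rootK.
(* Some p-power of [y] lies in F<a>, so sigma maps it into [M]; [rootM] then removes the p-th powers
   one at a time. *)
move=> _ [y _ <-]; have := idsub_valP y; rewrite {1}K_gen => -[n /aP[y' y'E]].
have -> : y' = y ^+ (p ^ n) by apply: idsub_val_inj; rewrite y'E rmorphXn.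
rewrite rmorphXn; elim: n {y'E} => [|n IHn]; first by rewrite expr1.
by rewrite expnSr exprM => /rootM.
Qed.

End Embedding.

Lemma galois_definably_closed : definably_closed p K.
Proof.
apply/seteqP; split=> [x [n xn]|x Kx].
  by apply: (@rootK _ n); apply: (@idgen_min _ _ K) xn.
by exists 0; rewrite expr1; apply: idgen_sub.
Qed.

End GaloisExtension.

Theorem theorem5p1 (p : nat) (p_prime : prime p)
    (U : idFieldType) (U_SCH : SCH_model p U) (U_sat : saturated U)
    (F : idSubfield U)
    (F_nontrivial : nontrivial_idfield F) (F_dcl : definably_closed p F)
    (CF_closed : GRing.closed_field_axiom (idsub_type (constants F)))
    (G : algGroup (idsub_type (constants F)))
    (alpha : arc_bundle G (base_alg F))
    (alpha_e : arc_proj alpha = ag_one G (base_alg F))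
    (alpha_im : exists g : G (univ_alg F),
        logder g = arc_map (base_univ_hom F) alpha)
    (K : idSubfield U)
    (K_gal : id_galois_extension p alpha K) :
  strongly_normal p F K.
Proof.
have [charU _ _ rootU] := U_SCH; have [a [a_sol K_gen CKF]] := K_gal.
have FK : (F : set U) `<=` K.
  by move=> x Fx; rewrite K_gen; exists 0; rewrite expr1; apply: idgen_sub; left.
have K_nontrivial : nontrivial_idfield K.
  by have [x Fx dx] := F_nontrivial; exists x => //; apply: FK.
split; first by split=> //; split=> //; apply: galois_definably_closed K_gen.
split; first by split.
- exact: galois_finitely_generated a_sol K_gen.
- by move=> sigma sigmaP; apply: (galois_embedding_image charU rootU a_sol K_gen sigmaP).
- exact: galois_algebraic_part a_sol K_gen.
Qed.
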